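(* The problem $\textsc{ssmSAT}^{\mathrm{fix}}_{\log}[\mathfrak{S}_{\mathrm{ti}}\cap\mathfrak{S}_{\mathrm{diag}}]$ is undecidable: there is no algorithm that, given an SSM $\mathcal{S}$ over a finite alphabet $\Sigma$ which is both time-invariant and diagonal, decides whether there is a word $w\in\Sigma^*$ with $\mathcal{S}(w)=1$, where $\mathcal{S}$ is evaluated on $w$ using fixed-width arithmetic with precision $\mathcal{O}(\log(\max(|\Sigma|,|w|)))$ bits.
   Context: A feedforward neural network (FNN) is a composition of layers of nodes, each node computing $\mathbf{x}\mapsto\mathit{relu}(\sum_i c_ix_i+b)$ with $\mathit{relu}(x)=\max(0,x)$. An SSM layer of dimension $d$ is a tuple $(\mathbf{h}_0,\mathit{gate},\mathit{inc},\phi)$ with $\mathbf{h}_0\in\mathbb{R}^d$, $\mathit{gate}\colon\mathbb{R}^d\to\mathbb{R}^{d\times d}$, $\mathit{inc}\colon\mathbb{R}^d\to\mathbb{R}^d$, $\phi\colon\mathbb{R}^d\times\mathbb{R}^d\to\mathbb{R}^d$ (computed by an FNN); on input $\mathbf{x}_1\cdots\mathbf{x}_k$ it computes $\mathbf{h}_t=\mathit{gate}(\mathbf{x}_t)\mathbf{h}_{t-1}+\mathit{inc}(\mathbf{x}_t)$ ($1\le t\le k$) and outputs $\mathbf{z}_t=\phi(\mathbf{h}_t,\mathbf{x}_t)$. An SSM over a finite alphabet $\Sigma$ with $L$ layers is a tuple $(\mathit{emb},l_1,\dots,l_L,\mathit{out})$ with $\mathit{emb}\colon\Sigma\to\mathbb{R}^d$,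 SSM layers $l_j$, and $\mathit{out}$ computed by an FNN; on $w=a_1\cdots a_k$ it sets $\mathbf{x}^0_i=\mathit{emb}(a_i)$, lets each layer $l_j$ map $\mathbf{x}^{j-1}_1\cdots\mathbf{x}^{j-1}_k$ to $\mathbf{x}^{j}_1\cdots\mathbf{x}^{j}_k$, and outputs $\mathcal{S}(w)=\mathit{out}(\mathbf{x}^L_k)$. All weights and constants are finitely represented. $\mathfrak{S}_{\mathrm{ti}}$ is the class of SSM in which every $\mathit{gate}$ is a constant matrix; $\mathfrak{S}_{\mathrm{diag}}$ is the class in which every $\mathit{gate}(\mathbf{x})$ is diagonal. Evaluating an SSM over fixed-width arithmetic with $b$ bits means that all values and all computations occurring in its evaluation are represented/carried out with $b$ bits (e.g. fixed- or floating-point; the result does not depend on the specific implementation). *)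

(* Defs.v *)
From HB Require Import structures.
From mathcomp Require Import all_boot all_order all_algebra.
From mathcomp Require Import reals zify.

Set Implicit Arguments.
Unset Strict Implicit.
Unset Printing Implicit Defensive.

Import Order.TTheory GRing.Theory Num.Theory.

Local Open Scope ring_scope.

(** * Arithmetics in which a network can be evaluated *)

Record arith := Arith {
  carrier :> Type;
  of_rat : rat -> carrier;
  fadd : carrier -> carrier -> carrier;
  fmul : carrier -> carrier -> carrier;
  frelu : carrier -> carrier
}.

Definition exact_arith (R : realType) : arith :=
  @Arith R (@ratr R) +%R *%R (Num.max 0).

(** A family, indexed by the number [b] of bits, of correctly rounded
    arithmetics.  [fw_val] is [None] on special values such as infinities and
    NaN, on which the operations are unconstrained.  Rounding is only required to
    be exact on representable numbers, so overflow may saturate, wrap around or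
    give a special value; several codes may denote the same number (signed
    zeros).  The last field asks that a fixed fraction of the [b] bits be
    available for integers, as in the usual fixed- and floating-point formats. *)
Record fixed_width := FixedWidth {
  fw_num : nat -> finType;
  fw_val : forall b, fw_num b -> option rat;
  fw_round : forall b, rat -> fw_num b;
  fw_add : forall b, fw_num b -> fw_num b -> fw_num b;
  fw_mul : forall b, fw_num b -> fw_num b -> fw_num b;
  fw_relu : forall b, fw_num b -> fw_num b;
  fw_card : forall b, (#|fw_num b| <= 2 ^ b)%N;
  fw_roundK : forall b (x : fw_num b) (q : rat),
    fw_val x = Some q -> fw_val (fw_round b q) = Some q;
  fw_addE : forall b (x y : fw_num b) (p q : rat),
    fw_val x = Some p -> fw_val y = Some q ->
    fw_val (fw_add x y) = fw_val (fw_round b (p + q));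
  fw_mulE : forall b (x y : fw_num b) (p q : rat),
    fw_val x = Some p -> fw_val y = Some q ->
    fw_val (fw_mul x y) = fw_val (fw_round b (p * q));
  fw_reluE : forall b (x : fw_num b) (p : rat),
    fw_val x = Some p -> fw_val (fw_relu x) = fw_val (fw_round b (Num.max 0 p));
  fw_range : exists2 k : nat, (0 < k)%N &
    forall (b : nat) (z : int), `|z| < (2 ^ (b %/ k))%N%:Z ->
      exists x : fw_num b, fw_val x = Some z%:~R
}.

Definition fw_arith (A : fixed_width) (b : nat) : arith :=
  @Arith (fw_num A b) (@fw_round A b) (@fw_add A b) (@fw_mul A b)
    (@fw_relu A b).

(** Non-vacuity: two's complement fixed point with [b %/ 2] fractional bits,
    rounding down and saturating. *)

Definition fp_off b : int := (2 ^ b %/ 2)%N%:Z.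
Definition fp_scale b : rat := (2 ^ (b %/ 2))%N%:R.
Lemma pow2_gt0 b : (0 < 2 ^ b)%N. Proof. by rewrite expn_gt0. Qed.
Definition fp_val b (x : 'I_(2 ^ b)) : rat := ((x : nat)%:Z - fp_off b)%:~R / fp_scale b.
Definition fp_clamp b (z : int) : nat :=
  if z < 0 then 0%N else minn `|z|%N (2 ^ b).-1.
Lemma fp_clampP b z : (fp_clamp b z < 2 ^ b)%N.
Proof. rewrite /fp_clamp; have := pow2_gt0 b; case: ifP => _; lia. Qed.
Definition fp_round b (q : rat) : 'I_(2 ^ b) :=
  Ordinal (fp_clampP b (Num.floor (q * fp_scale b) + fp_off b)).
Lemma fp_scale_gt0 b : 0 < fp_scale b. Proof. by rewrite ltr0n pow2_gt0. Qed.
Lemma fp_valK b x : fp_round b (fp_val x) = x.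
Proof.
apply: val_inj => /=; rewrite /fp_val divfK ?gt_eqF ?fp_scale_gt0 // intrKfloor subrK.
rewrite /fp_clamp /=; have := ltn_ord x; case: x => x hx /=; lia.
Qed.
Lemma fp_range (b : nat) (z : int) : `|z| < (2 ^ (b %/ 4))%N%:Z ->
  exists x : 'I_(2 ^ b), Some (fp_val x) = Some z%:~R.
Proof.
move=> hz.
have hb : (b < 4)%N \/ (b %/ 4 + b %/ 2 <= b.-1)%N by lia.
pose y : int := z * (2 ^ (b %/ 2))%N%:Z.
have hy : - fp_off b <= y /\ y + fp_off b < (2 ^ b)%N%:Z.
  case: hb => hb.
    have e0 : (b %/ 4 = 0)%N by lia.
    have z0 : z = 0 by move: hz; rewrite e0; lia.
    by rewrite /y z0 mul0r /fp_off; have := pow2_gt0 b; lia.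
  case: b hz hb @y => [|b] hz hb y.
    have z0 : z = 0 by move: hz; rewrite expn0; lia.
    by rewrite /y z0 mul0r /fp_off.
  have h1 : (2 ^ (b.+1 %/ 4) * 2 ^ (b.+1 %/ 2) <= 2 ^ b)%N.
    by rewrite -expnD leq_exp2l.
  have h5 : `|y| < (2 ^ b)%N%:Z.
    apply: (@lt_le_trans _ _ (2 ^ (b.+1 %/ 4) * 2 ^ (b.+1 %/ 2))%N%:Z); last by rewrite lez_nat.
    by rewrite /y normrM PoszM ltr_pM2r // ltz_nat pow2_gt0.
  by rewrite /fp_off expnS mulKn //; lia.
have hx : (absz (y + fp_off b)%R < 2 ^ b)%N by lia.
exists (Ordinal hx); congr Some; rewrite /fp_val /=.
have -> : ((absz (y + fp_off b)%R)%:Z - fp_off b) = y by lia.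
rewrite /y intrM /fp_scale mulfK //.
by rewrite intr_eq0; have := pow2_gt0 (b %/ 2); lia.
Qed.
Definition fixed_point : fixed_width.
Proof.
refine (@FixedWidth (fun b => 'I_(2^b)) (fun b x => Some (fp_val x)) (fun b q => fp_round b q)
 (fun b x y => fp_round b (fp_val x + fp_val y))
 (fun b x y => fp_round b (fp_val x * fp_val y))
 (fun b x => fp_round b (Num.max 0 (fp_val x))) _ _ _ _ _ _).
- by move=> b; rewrite card_ord.
- by move=> b x q [<-]; rewrite fp_valK.
- by move=> b x y p q [<-] [<-].
- by move=> b x y p q [<-] [<-].
- by move=> b x p [<-].
- by exists 4%N => // b z /fp_range.
Defined.

(** * Feedforward networks *)

Record layer (m n : nat) := Layer {
  weight : 'M[rat]_(n, m);
  bias : 'cV[rat]_n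
}.

(** [net n m] is the type of networks with [m] inputs and [n] outputs. *)
Inductive net (n : nat) : nat -> Type :=
| NetLast m of layer m n : net n m
| NetCons m k of layer m k & net n k : net n m.

Section Networks.
Variable A : arith.

(** [M x + c]; each sum is computed as
    [M i 0 * x 0 + (M i 1 * x 1 + (... + c i))]. *)
Definition affine m n (M : 'M[A]_(n, m)) (c : 'cV[A]_n) (x : 'cV[A]_m) :
    'cV[A]_n :=
  \col_i \big[@fadd A/c i ord0]_(j < m) fmul (M i j) (x j ord0).

Definition layer_affine m n (l : layer m n) (x : 'cV[A]_m) : 'cV[A]_n :=
  affine (map_mx (@of_rat A) (weight l)) (map_mx (@of_rat A) (bias l)) x.

Fixpoint net_eval (out_act : A -> A) n m (N : net n m) :
    'cV[A]_m -> 'cV[A]_n :=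
  match N in net _ m return 'cV[A]_m -> 'cV[A]_n with
  | NetLast _ l => fun x => map_mx out_act (layer_affine l x)
  | NetCons _ _ l N' => fun x =>
      net_eval out_act N' (map_mx (@frelu A) (layer_affine l x))
  end.

Definition fnn_eval n m (N : net n m) : 'cV[A]_m -> 'cV[A]_n :=
  net_eval (@frelu A) N.

(** No activation at the output nodes; used for [gate] and [inc], whose values
    may be negative. *)
Definition pwl_eval n m (N : net n m) : 'cV[A]_m -> 'cV[A]_n := net_eval id N.

End Networks.

(** * State space models *)

(** A constant gate is given by its matrix, so that no computation (hence no
    rounding besides that of the entries) is involved in evaluating it. *)
Inductive gate_fun (d : nat) : Type :=
| GateConst of 'M[rat]_d
| GateNet of net (d * d) d.

Record ssm_layer (d : nat) := SSMLayer {
  h0 : 'cV[rat]_d;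
  gate : gate_fun d;
  inc : net d d;
  phi : net d (d + d)
}.

(** The alphabet is ['I_asize]. *)
Record ssm := SSM {
  dim : nat;
  asize : nat;
  emb : {ffun 'I_asize -> 'cV[rat]_dim};
  nlayers : nat;
  layers : nlayers.-tuple (ssm_layer dim);
  out : net 1 dim
}.

Section Evaluation.
Variable A : arith.

Definition gate_eval d (l : ssm_layer d) (x : 'cV[A]_d) : 'M[A]_d :=
  match gate l with
  | GateConst M => map_mx (@of_rat A) M
  | GateNet N => vec_mx (pwl_eval N x)^T
  end.

Definition ssm_step d (l : ssm_layer d) (h x : 'cV[A]_d) : 'cV[A]_d :=
  affine (gate_eval l x) (pwl_eval (inc l) x) h.

Definition ssm_states d (l : ssm_layer d) (xs : seq 'cV[A]_d) :
    seq 'cV[A]_d :=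
  scanl (ssm_step l) (map_mx (@of_rat A) (h0 l)) xs.

Definition ssm_layer_eval d (l : ssm_layer d) (xs : seq 'cV[A]_d) :
    seq 'cV[A]_d :=
  [seq fnn_eval (phi l) (col_mx hx.1 hx.2) | hx <- zip (ssm_states l xs) xs].

(** Undefined on the empty word, which has no last position. *)
Definition ssm_eval (S : ssm) (w : seq 'I_(asize S)) : option A :=
  let xs0 := [seq map_mx (@of_rat A) (emb S a) | a <- w] in
  let xsL := foldl (fun xs l => ssm_layer_eval l xs) xs0 (layers S) in
  omap (fun x => fnn_eval (out S) x ord0 ord0) (ohead (rev xsL)).

End Evaluation.

Definition time_invariant (S : ssm) : Prop :=
  forall j : 'I_(nlayers S), exists M : 'M[rat]_(dim S),
    gate (tnth (layers S) j) = GateConst M.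

Definition diagonal (R : realType) (S : ssm) : Prop :=
  forall (j : 'I_(nlayers S)) (x : 'cV[R]_(dim S)),
    is_diag_mx (@gate_eval (exact_arith R) _ (tnth (layers S) j) x : 'M[R]__).

(** * Satisfiability *)

Definition O_log (p : nat -> nat) : Prop :=
  exists C n0 : nat, forall n, (n0 <= n)%N -> (p n <= C * trunc_log 2 n)%N.

Definition ssmSAT_fix (A : fixed_width) (p : nat -> nat) (S : ssm) : Prop :=
  exists w : seq 'I_(asize S),
  exists y : fw_num A (p (maxn (asize S) (size w))),
    @ssm_eval (fw_arith A (p (maxn (asize S) (size w)))) S w = Some y /\
    fw_val y = Some 1.

(** * Algorithms: partial recursive functions on natural numbers *)

Inductive mu_rec : nat -> Type :=
| MuZero k : mu_rec k
| MuSucc : mu_rec 1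
| MuProj k of 'I_k : mu_rec k
| MuComp k m of mu_rec m & ('I_m -> mu_rec k) : mu_rec k
| MuPrim k of mu_rec k & mu_rec k.+2 : mu_rec k.+1
| MuMin k of mu_rec k.+1 : mu_rec k.

(** [mu_eval f v y]: [f] is defined at [v], with value [y]. *)
Fixpoint mu_eval k (f : mu_rec k) : k.-tuple nat -> nat -> Prop :=
  match f in mu_rec k return k.-tuple nat -> nat -> Prop with
  | MuZero _ => fun _ y => y = 0%N
  | MuSucc => fun v y => y = (thead v).+1
  | MuProj _ i => fun v y => y = tnth v i
  | MuComp _ m g hs => fun v y =>
      exists2 u : m.-tuple nat,
        forall i, mu_eval (hs i) v (tnth u i) & mu_eval g u y
  | MuPrim k g h => fun v y =>
      let params : k.-tuple nat := [tuple of behead v] in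
      (fix iter_rel n y := match n with
        | 0%N => mu_eval g params y
        | n'.+1 => exists2 z, iter_rel n' z &
                     mu_eval h [tuple of n' :: z :: params] y
        end) (thead v) y
  | MuMin _ g => fun v y =>
      mu_eval g [tuple of y :: v] 0 /\
      forall j, (j < y)%N -> exists z, mu_eval g [tuple of j :: v] z.+1
  end.

(** * Encoding of state space models as natural numbers *)

Notation code := CodeSeq.code.

Definition enc_int (z : int) : nat :=
  match z with Posz n => n.*2 | Negz n => n.*2.+1 end.

Definition enc_rat (q : rat) : nat :=
  code [:: enc_int (numq q); enc_int (denq q)].

Definition enc_mx m n (M : 'M[rat]_(m, n)) : nat :=
  code [:: m; n;
    code [seq code [seq enc_rat (M i j) | j <- enum 'I_n] | i <- enum 'I_m]].

Definition enc_layer m n (l : layer m n) : nat :=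
  code [:: enc_mx (weight l); enc_mx (bias l)].

Fixpoint enc_layers n m (N : net n m) : seq nat :=
  match N with
  | NetLast _ l => [:: enc_layer l]
  | NetCons _ _ l N' => enc_layer l :: enc_layers N'
  end.

Definition enc_net n m (N : net n m) : nat := code (enc_layers N).

Definition enc_gate d (g : gate_fun d) : nat :=
  match g with
  | GateConst M => code [:: 0; enc_mx M]%N
  | GateNet N => code [:: 1; enc_net N]%N
  end.

Definition enc_ssm_layer d (l : ssm_layer d) : nat :=
  code [:: enc_mx (h0 l); enc_gate (gate l); enc_net (inc l); enc_net (phi l)].

Definition enc_ssm (S : ssm) : nat :=
  code [:: dim S; asize S;
    code [seq enc_mx (emb S a) | a <- enum 'I_(asize S)];
    code [seq enc_ssm_layer l | l <- layers S];
    enc_net (out S)].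

Lemma code_inj : injective code. Proof. exact: can_inj CodeSeq.codeK. Qed.
Lemma enc_int_inj : injective enc_int.
Proof. by case=> n; case=> m //= H; try (congr Posz); try (congr Negz); lia. Qed.
Lemma enc_rat_inj : injective enc_rat.
Proof.
move=> x y /code_inj[] /enc_int_inj hn /enc_int_inj hd.
by rewrite -(divq_num_den x) -(divq_num_den y) hn hd.
Qed.
Lemma enc_mx_dim m n m' n' (M : 'M[rat]_(m,n)) (M' : 'M_(m',n')) :
  enc_mx M = enc_mx M' -> m = m' /\ n = n'.
Proof. by move=> /code_inj[h1 h2 _]. Qed.
Lemma enc_mx_inj m n : injective (@enc_mx m n).
Proof.
move=> M M' /code_inj[/code_inj h]; apply/matrixP=> i j.
have := h => /eq_in_map /(_ i); rewrite mem_enum => /(_ isT) /code_inj.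
by move=> /eq_in_map /(_ j); rewrite mem_enum => /(_ isT) /enc_rat_inj.
Qed.
Lemma enc_layer_inj m n : injective (@enc_layer m n).
Proof. by case=> W b [W' b'] /code_inj[] /enc_mx_inj /= -> /enc_mx_inj /= ->. Qed.
Lemma enc_layer_dim m n m' n' (l : layer m n) (l' : layer m' n') :
  enc_layer l = enc_layer l' -> n = n'.
Proof. by move=> /code_inj[] /enc_mx_dim[]. Qed.
Lemma enc_layers_inj n m : injective (@enc_layers n m).
Proof.
move=> N1; elim: m / N1 => [m l|m k l N IH] N2.
- move: l; case: m / N2 => [m l'|m k' l' N'] l /=.
    by case=> /enc_layer_inj ->.
  by case=> _ h; have : size (enc_layers N') = 0%N; [rewrite -h|destruct N'].
- move: l; case: m / N2 => [m l'|m k' l' N'] l /=.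
    by case=> _ h; have : size (enc_layers N) = 0%N; [rewrite h|destruct N].
  case=> e h; have ek := enc_layer_dim e; subst k'.
  by rewrite (enc_layer_inj e) (IH _ h).
Qed.
Lemma enc_gate_inj d : injective (@enc_gate d).
Proof.
case=> [M|N] [M'|N'] /code_inj //= -[]; first by move=> /enc_mx_inj ->.
by move=> /code_inj/enc_layers_inj ->.
Qed.
Lemma enc_ssm_layer_inj d : injective (@enc_ssm_layer d).
Proof.
case=> a b c e [a' b' c' e'] /code_inj[] /= /enc_mx_inj-> /enc_gate_inj->.
by move=> /code_inj/enc_layers_inj -> /code_inj/enc_layers_inj ->.
Qed.
Lemma enc_ssm_inj : injective enc_ssm.
Proof.
case=> d k e L ls o [d' k' e' L' ls' o'] /code_inj[] /= hd hk; subst d' k'.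
move=> /code_inj he /code_inj hl /code_inj/enc_layers_inj ->.
have -> : e = e'.
  apply/ffunP=> a; move: he => /eq_in_map /(_ a).
  by rewrite mem_enum => /(_ isT) /enc_mx_inj.
have hs : tval ls = tval ls' by move: hl; apply: inj_map; exact: enc_ssm_layer_inj.
have eL : L = L' by rewrite -(size_tuple ls) hs size_tuple.
subst L'. by have -> : ls = ls' by apply: val_inj.
Qed.

(** * Decidability of a property of the models of a class [C]

    Nothing is required of the algorithm on other inputs. *)

Definition decides (f : mu_rec 1) (C P : ssm -> Prop) : Prop :=
  forall S : ssm, C S ->
    exists2 b : bool, mu_eval f [tuple enc_ssm S] b & b <-> P S.

Definition decidable_on (C P : ssm -> Prop) : Prop :=
  exists f : mu_rec 1, decides f C P.

(* Main.v *)
Require Import Defs.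
From HB Require Import structures.
From mathcomp Require Import all_boot all_order all_algebra.
From mathcomp Require Import reals zify.

(** A mu-recursive function is compiled to a nondeterministic program on registers, with
    increments, guarded decrements, equality tests and loops.  A word is a sequence of
    transitions (source point, action, target point) of this program, and a model all of whose
    layers compute prefix sums (the gates are identity matrices) can check that it is a run:
    the transitions are chained iff the prefix sums of [target - source] telescope to the
    current target, register values are prefix sums of increments minus decrements, and guards
    are piecewise linear conditions on them.  A second prefix sum adds up the violations.

    The input [n] of the program must not occur as a weight, since it might not be
    representable when the word is short.  It is the number of copies of one fixed layer, which
    adds 1 to a coordinate and clips it at [c + 1], where [c] is the final value of the input
    register: after [n] layers the coordinate is [min n (c + 1)], which equals [c] iff
    [n = c].  All intermediate values are integers bounded by a power of the length of the word
    or of the size of the alphabet, hence exactly represented.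

    The code of the model is a simple recursive function of [n] and of finitely many constants.
    Given a decision procedure [f], let [g x] halt iff [f] rejects the model obtained by reading
    the constants off [x] and taking [n = x].  The model of [g], with [n] the tuple of its own
    constants, refutes [f]. *)

Set Implicit Arguments.
Unset Strict Implicit.
Unset Printing Implicit Defensive.

(** * Recursive functions *)

(** The anonymous fixpoint inside [mu_eval] at [MuPrim], named so that inductions on the counter can
    be stated for it. *)
Fixpoint prim_rel (g : nat -> Prop) (h : nat -> nat -> nat -> Prop) n y : Prop :=
  match n with
  | 0 => g y
  | n'.+1 => exists2 z, prim_rel g h n' z & h n' z y
  end.

Lemma mu_eval_prim k (g : mu_rec k) (h : mu_rec k.+2) (v : k.+1.-tuple nat) y :
  mu_eval (MuPrim g h) v y <->
  prim_rel (mu_eval g [tuple of behead v])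
    (fun n z => mu_eval h [tuple of n :: z :: [tuple of behead v]]) (thead v) y.
Proof.
rewrite /=; elim: (thead v) y => [|n IH] y //=.
by split=> -[z /IH hz hy]; exists z.
Qed.

Lemma mu_eval_fun k (f : mu_rec k) v y z : mu_eval f v y -> mu_eval f v z -> y = z.
Proof.
elim: f v y z => {k} [k|| k i|k m g IHg hs IHhs|k g IHg h IHh|k g IHg] v y z.
- by move=> /= -> ->.
- by move=> /= -> ->.
- by move=> /= -> ->.
- move=> [u hu gu] [u' hu' gu'].
  have e : u = u' by apply: eq_from_tnth => i; apply: IHhs (hu i) (hu' i).
  by rewrite -e in gu'; apply: IHg gu gu'.
- move=> /mu_eval_prim hy /mu_eval_prim.
  elim: (thead v) y z hy => [|n IH] y z /=; first exact: IHg.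
  by move=> [a ha hy] [b hb]; rewrite -(IH _ _ ha hb); apply: IHh.
- move=> /= [y0 hy] [z0 hz]; case: (ltngtP y z) => // lt.
    by have [t /IHg/(_ y0)] := hz _ lt.
  by have [t /IHg/(_ z0)] := hy _ lt.
Qed.

(** * Closure properties of total computable functions *)

Definition computable k (F : k.-tuple nat -> nat) :=
  exists f : mu_rec k, forall v, mu_eval f v (F v).

Lemma computable_ext k (F G : k.-tuple nat -> nat) :
  F =1 G -> computable F -> computable G.
Proof. by move=> e [f hf]; exists f => v; rewrite -e. Qed.

Lemma computable_proj k (i : 'I_k) : computable (fun v => tnth v i).
Proof. by exists (MuProj i). Qed.

Lemma computable_comp k m (G : m.-tuple nat -> nat) (H : 'I_m -> k.-tuple nat -> nat) :
  computable G -> (forall i, computable (H i)) ->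
  computable (fun v => G [tuple H i v | i < m]).
Proof.
move=> [g hg] /fin_all_exists[hs hhs]; exists (MuComp g hs) => v /=.
by exists [tuple H i v | i < m] => // i; rewrite tnth_mktuple.
Qed.

Definition computable1 (g : nat -> nat) := computable (fun v : 1.-tuple nat => g (thead v)).
Definition computable2 (g : nat -> nat -> nat) :=
  computable (fun v : 2.-tuple nat => g (tnth v ord0) (tnth v ord_max)).

Lemma computable_app1 k (g : nat -> nat) (F : k.-tuple nat -> nat) :
  computable1 g -> computable F -> computable (fun v => g (F v)).
Proof.
move=> hg hF; have := computable_comp hg (fun=> hF); apply: computable_ext => v.
by rewrite /thead tnth_mktuple.
Qed.

Lemma computable_app2 k (g : nat -> nat -> nat) (F G : k.-tuple nat -> nat) :
  computable2 g -> computable F -> computable G -> computable (fun v => g (F v) (G v)).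
Proof.
move=> hg hF hG.
have h (i : 'I_2) : computable (if i == ord0 then F else G) by case: ifP.
by have := computable_comp hg h; apply: computable_ext => v; rewrite !tnth_mktuple.
Qed.

Lemma computable_prim k (g : k.-tuple nat -> nat) (h : k.+2.-tuple nat -> nat)
    (F : nat -> k.-tuple nat -> nat) :
  computable g -> computable h ->
  (forall v, F 0 v = g v) ->
  (forall n v, F n.+1 v = h [tuple of n :: F n v :: v]) ->
  computable (fun v : k.+1.-tuple nat => F (thead v) [tuple of behead v]).
Proof.
move=> [f hf] [f' hf'] F0 FS; exists (MuPrim f f') => v; apply/mu_eval_prim.
elim: (thead v) => [|n IH] /=; first by rewrite F0.
by exists (F n [tuple of behead v]); rewrite ?FS.
Qed.

Lemma computable_min k (g : k.+1.-tuple nat -> nat) (F : k.-tuple nat -> nat) :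
  computable g -> (forall v, g [tuple of F v :: v] = 0) ->
  (forall v j, j < F v -> 0 < g [tuple of j :: v]) -> computable F.
Proof.
move=> [f hf] g0 gS; exists (MuMin f) => v /=; split; first by rewrite -[X in mu_eval _ _ X](g0 v).
move=> j /gS; have := hf [tuple of j :: v].
by case: (g _) => // z hz _; exists z.
Qed.

Lemma computable_cst k n : computable (fun _ : k.-tuple nat => n).
Proof.
elim: n => [|n [f hf]]; first by exists (MuZero k).
by exists (MuComp MuSucc (fun=> f)) => v /=; exists [tuple n] => // i; rewrite (ord1 i).
Qed.

Lemma computable_succ : computable1 succn.
Proof. by exists MuSucc. Qed.

Lemma computable_swap g : computable2 g -> computable2 (fun x y => g y x).
Proof. by move=> hg; apply: computable_app2 hg _ _; apply: computable_proj. Qed.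

Lemma computable_rec (g : nat -> nat) (h : nat -> nat -> nat -> nat) (F : nat -> nat -> nat) :
  computable1 g ->
  computable (fun v : 3.-tuple nat =>
    h (tnth v ord0) (tnth v (lift ord0 ord0)) (tnth v ord_max)) ->
  (forall a, F 0 a = g a) -> (forall n a, F n.+1 a = h n (F n a) a) -> computable2 F.
Proof.
move=> hg hh F0 FS.
have FS' n (v : 1.-tuple nat) : F n.+1 (thead v) =
    h (tnth [tuple of n :: F n (thead v) :: v] ord0)
      (tnth [tuple of n :: F n (thead v) :: v] (lift ord0 ord0))
      (tnth [tuple of n :: F n (thead v) :: v] ord_max).
  by rewrite FS /thead !(tnth_nth 0).
have := @computable_prim 1 _ _ (fun n v => F n (thead v)) hg hh (fun v => F0 (thead v)) FS'.
apply: computable_ext => v /=; rewrite !(tnth_nth 0) /=.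
by case: v => -[|a [|b [|]]].
Qed.

Lemma computable_add : computable2 addn.
Proof.
apply: (@computable_rec id (fun _ r _ => r.+1)) => //; first exact: computable_proj.
by apply: computable_app1 computable_succ _; apply: computable_proj.
Qed.

Lemma computable_mul : computable2 muln.
Proof.
apply: (@computable_rec (fun=> 0) (fun _ r a => a + r)) => //; first exact: computable_cst.
by apply: computable_app2 computable_add _ _; apply: computable_proj.
Qed.

Lemma computable_pow2 : computable1 (expn 2).
Proof.
have h : computable2 (fun n _ => 2 ^ n).
  apply: (@computable_rec (fun=> 1) (fun _ r _ => r + r)) => //; first exact: computable_cst.
    by apply: computable_app2 computable_add _ _; apply: computable_proj.
  by move=> n _; rewrite expnS mul2n addnn.
exact: (computable_app2 h (computable_proj ord0) (computable_proj ord0)).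
Qed.

Lemma computable_pred : computable1 predn.
Proof.
have h : computable2 (fun n _ => n.-1).
  apply: (@computable_rec (fun=> 0) (fun n _ _ => n)) => //; first exact: computable_cst.
  exact: computable_proj.
exact: (computable_app2 h (computable_proj ord0) (computable_proj ord0)).
Qed.

Lemma computable_sub : computable2 subn.
Proof.
apply: (@computable_swap (fun x y => y - x)).
apply: (@computable_rec id (fun _ r _ => r.-1) (fun x y => y - x)).
- exact: computable_proj.
- by apply: computable_app1 computable_pred _; apply: computable_proj.
- exact: subn0.
- by move=> n a; rewrite subnS.
Qed.

(** * Pairing, codes of sequences and the diagonal *)

Definition pair_code a b := (a + b) ^ 2 + a.

Lemma nat_sqrt_exists x : exists s, x < s.+1 ^ 2.
Proof. by exists x; nia. Qed.
Definition nat_sqrt x := ex_minn (nat_sqrt_exists x).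
Definition pair_fst x := x - nat_sqrt x ^ 2.
Definition pair_snd x := nat_sqrt x - pair_fst x.

(** Since [a <= 2 * (a + b)], the code lies strictly below the next square [(a + b).+1 ^ 2]. The
    pairing is not onto, but decoding takes only an integer square root. *)
Lemma nat_sqrt_pair a b : nat_sqrt (pair_code a b) = a + b.
Proof.
rewrite /nat_sqrt /pair_code; case: ex_minnP => s hs hmin.
have : s <= a + b by apply: hmin; nia.
by move: hs => /= hs1 hs2; nia.
Qed.
Lemma pair_fstK a b : pair_fst (pair_code a b) = a.
Proof. by rewrite /pair_fst nat_sqrt_pair addKn. Qed.
Lemma pair_sndK a b : pair_snd (pair_code a b) = b.
Proof. by rewrite /pair_snd pair_fstK nat_sqrt_pair addKn. Qed.

Lemma computable_sqr : computable1 (fun x => x ^ 2).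
Proof. by apply: computable_app2 computable_mul _ _; apply: computable_proj. Qed.

Lemma computable_sqrt : computable1 nat_sqrt.
Proof.
apply: (@computable_min 1 (fun v => (tnth v ord_max).+1 - (tnth v ord0).+1 ^ 2)).
- apply: computable_app2 computable_sub _ _.
    by apply: computable_app1 computable_succ _; apply: computable_proj.
  apply: (computable_app1 computable_sqr (F := fun v : 2.-tuple nat => (tnth v ord0).+1)).
  by apply: computable_app1 computable_succ _; apply: computable_proj.
- move=> v; rewrite /nat_sqrt; case: ex_minnP => s hs _; apply/eqP; rewrite subn_eq0.
  by rewrite !(tnth_nth 0) /=; move: hs; case: v => -[|a [|]].
- move=> v j; rewrite /nat_sqrt; case: ex_minnP => s _ hmin hj; rewrite subn_gt0.
  rewrite !(tnth_nth 0) /= ltnS; move: hmin; case: v => -[|a [|]] //= ? hmin.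
  by case: leqP => // /hmin; rewrite leqNgt hj.
Qed.

Lemma computable_fst : computable1 pair_fst.
Proof.
apply: computable_app2 computable_sub _ _; first exact: computable_proj.
apply: (computable_app1 computable_sqr); exact: computable_sqrt.
Qed.

Lemma computable_snd : computable1 pair_snd.
Proof.
by apply: computable_app2 computable_sub _ _; [exact: computable_sqrt|exact: computable_fst].
Qed.

(** One step of the fold that defines [CodeSeq.code]. *)
Definition code_cons n m := 2 ^ n * m.*2.+1.

Lemma computable_cons : computable2 code_cons.
Proof.
apply: computable_app2 computable_mul _ _.
  by apply: computable_app1 computable_pow2 _; apply: computable_proj.
apply: (computable_app1 computable_succ); apply: (@computable_ext _
  (fun v : 2.-tuple nat => tnth v ord_max + tnth v ord_max)) => [v|]; first by rewrite addnn.
by apply: computable_app2 computable_add _ _; apply: computable_proj.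
Qed.

(* The parameter packs the head to be repeated and the tail. *)
Lemma computable_iter_cons :
  computable2 (fun n a => iter n (code_cons (pair_fst a)) (pair_snd a)).
Proof.
apply: (@computable_rec pair_snd (fun _ r a => code_cons (pair_fst a) r)) => //.
  exact: computable_snd.
apply: computable_app2 computable_cons _ _; last exact: computable_proj.
by apply: computable_app1 computable_fst _; apply: computable_proj.
Qed.

(** The shape of [enc_ssm] on a model with [n] copies of a layer of code [D]: [d], [k] and [e] stand
    for the dimension, the alphabet size and the embedding, [r] for the list of the remaining
    layers, [o] for the final list holding the output network. *)
Definition template_code d k e D r o n :=
  code_cons d (code_cons k (code_cons e (code_cons (iter n (code_cons D) r) o))).

Definition pack d k e D r o :=
  pair_code d (pair_code k (pair_code e (pair_code o (pair_code D r)))).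

(** Self-application: the constants are unpacked from [x], and [x] itself is the number of copies.
    In [pack], [D] and [r] come last so that the remainder [x4] is directly the packed parameter of
    [computable_iter_cons]. *)
Definition diag_code x :=
  let x1 := pair_snd x in let x2 := pair_snd x1 in let x3 := pair_snd x2 in
  let x4 := pair_snd x3 in
  code_cons (pair_fst x) (code_cons (pair_fst x1) (code_cons (pair_fst x2)
    (code_cons (iter x (code_cons (pair_fst x4)) (pair_snd x4)) (pair_fst x3)))).

Lemma diag_codeE d k e D r o :
  diag_code (pack d k e D r o) = template_code d k e D r o (pack d k e D r o).
Proof. by rewrite /diag_code /pack !pair_sndK !pair_fstK. Qed.

Lemma computable_diag : computable1 diag_code.
Proof.
have c0 : computable (fun v : 1.-tuple nat => thead v) by exact: computable_proj.
have c1 := computable_app1 computable_snd c0; have c2 := computable_app1 computable_snd c1.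
have c3 := computable_app1 computable_snd c2; have c4 := computable_app1 computable_snd c3.
apply: (computable_app2 computable_cons (computable_app1 computable_fst c0)).
apply: (computable_app2 computable_cons (computable_app1 computable_fst c1)).
apply: (computable_app2 computable_cons (computable_app1 computable_fst c2)).
apply: (computable_app2 computable_cons (computable_app2 computable_iter_cons c0 c4)).
exact: (computable_app1 computable_fst c3).
Qed.

(* [g x] searches for a zero of a function that does not depend on the searched variable. *)
Lemma diagonal_halting (f : mu_rec 1) : exists g : mu_rec 1, forall x b,
  mu_eval f [tuple diag_code x] b ->
  ((exists y, mu_eval g [tuple x] y) <-> b = 0).
Proof.
have [e he] := computable_app1 computable_diag (@computable_proj 2 ord_max).
exists (MuMin (MuComp f (fun=> e))) => x b hb; split=> [[y [[u hu hf] _]]|b0].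
  have eu : u = [tuple diag_code x].
    by apply: eq_from_tnth => i; rewrite (ord1 i); apply: mu_eval_fun (hu _) (he _).
  by rewrite eu in hf; apply: mu_eval_fun hb hf.
exists 0; split=> //; exists [tuple diag_code x]; last by rewrite b0 in hb.
by move=> i; rewrite (ord1 i); apply: he.
Qed.

(** * Register programs *)

Inductive prog :=
| PInc of nat
| PDec of nat
| PEq of nat & nat
| PSeq of prog & prog
| PStar of prog.

Definition store := nat -> nat.
Definition upd (s : store) r n : store := fun i => if i == r then n else s i.

Inductive star T (R : T -> T -> Prop) (x : T) : T -> Prop :=
| star0 : star R x x
| starS y z of R x y & star R y z : star R x z.

Fixpoint exec (P : prog) (s s' : store) : Prop :=
  match P with
  | PInc r => s' = upd s r (s r).+1
  | PDec r => 0 < s r /\ s' = upd s r (s r).-1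
  | PEq i j => s i = s j /\ s' = s
  | PSeq P Q => exists2 s1, exec P s s1 & exec Q s1 s'
  | PStar P => star (exec P) s s'
  end.

Lemma star_inv T (R : T -> T -> Prop) (I : T -> Prop) x y :
  (forall x y, I x -> R x y -> I y) -> star R x y -> I x -> I y.
Proof. by move=> hI; elim=> // {}x {}y z Rxy _ IH Ix; apply: IH; apply: hI Rxy. Qed.

Lemma updE s r n : upd s r n r = n.
Proof. by rewrite /upd eqxx. Qed.
Lemma updN s r n i : i != r -> upd s r n i = s i.
Proof. by rewrite /upd => /negbTE->. Qed.

(** Nondeterminism replaces copying loops: the target register is given an arbitrary value, and the
    equality test in [copy] discards the wrong guesses. *)
Definition havoc r := PSeq (PStar (PDec r)) (PStar (PInc r)).
Definition copy i j := PSeq (havoc j) (PEq i j).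
Definition skip := PEq 0 0.

Lemma havoc_frame r s s' i : exec (havoc r) s s' -> i != r -> s' i = s i.
Proof.
move=> [s1 h1 h2] ir.
apply: (star_inv (I := fun t => t i = s i) _ h2).
  by move=> x y <- ->; rewrite updN.
apply: (star_inv (I := fun t => t i = s i) _ h1) => //.
by move=> x y <- [_ ->]; rewrite updN.
Qed.

Lemma havoc_any r s n : exists2 s', exec (havoc r) s s' & s' r = n.
Proof.
have [s1 h1 e1] : exists2 s', star (exec (PDec r)) s s' & s' r = 0.
  move e : (s r) => k; elim: k s e => [|k IH] s e; first by exists s => //; left.
  have [|s' h h0] := IH (upd s r (s r).-1); first by rewrite updE e.
  by exists s' => //; apply: starS h; split; rewrite ?e.
have [s2 h2 e2] : exists2 s', star (exec (PInc r)) s1 s' & s' r = s1 r + n.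
  elim: n s1 {h1 e1} => [|n IH] s1; first by exists s1; rewrite ?addn0 //; left.
  have [s' h h0] := IH (upd s1 r (s1 r).+1).
  by exists s'; [apply: starS h|rewrite h0 updE addnS].
by exists s2; [exists s1|rewrite e2 e1].
Qed.

Lemma copy_sound i j s s' : i != j -> exec (copy i j) s s' ->
  s' j = s i /\ forall r, r != j -> s' r = s r.
Proof.
move=> ij [s1 h1 [e ->]]; split=> [|r rj]; last exact: havoc_frame h1 rj.
by rewrite -e (havoc_frame h1).
Qed.

Lemma copy_complete i j s : i != j -> exists s', exec (copy i j) s s'.
Proof.
move=> ij; have [s' h e] := havoc_any j s (s i).
by exists s'; exists s' => //; split=> //; rewrite e (havoc_frame h).
Qed.

(** * Compilation of recursive functions to register programs *)

Definition seqs := foldr PSeq skip.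

(* Register 0 is never written and holds 0; registers from [fr] on are scratch. *)
Fixpoint compile k (f : mu_rec k) : k.-tuple nat -> nat -> nat -> prog :=
  match f in mu_rec k return k.-tuple nat -> nat -> nat -> prog with
  | MuZero _ => fun _ out _ => copy 0 out
  | MuSucc => fun ins out _ => PSeq (copy (thead ins) out) (PInc out)
  | MuProj _ i => fun ins out _ => copy (tnth ins i) out
  | MuComp _ m g hs => fun ins out fr =>
      PSeq (seqs [seq compile (hs i) ins (fr + i) (fr + m) | i <- enum 'I_m])
           (compile g [tuple fr + i | i < m] out (fr + m))
  | MuPrim k g h => fun ins out fr =>
      let pars : k.-tuple nat := [tuple of behead ins] in
      PSeq (copy 0 fr) (PSeq (compile g pars fr.+1 fr.+3)
      (PSeq (PStar (PSeq (compile h [tuple of fr :: fr.+1 :: pars] fr.+2 fr.+3)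
                   (PSeq (copy fr.+2 fr.+1) (PInc fr))))
      (PSeq (PEq fr (thead ins)) (copy fr.+1 out))))
  | MuMin _ g => fun ins out fr =>
      let body := compile g [tuple of fr :: ins] fr.+1 fr.+2 in
      PSeq (copy 0 fr)
      (PSeq (PStar (PSeq body (PSeq (PDec fr.+1) (PInc fr))))
      (PSeq body (PSeq (PEq fr.+1 0) (copy fr out))))
  end.

Definition regs_ok (ins : seq nat) out fr :=
  [/\ all (fun r => r < fr) ins, out \notin ins, out < fr & 0 < out].

Definition same_below fr out (s s' : store) := forall r, r < fr -> r != out -> s' r = s r.

(** As [exec] is a relation, soundness concerns every terminating execution, whatever its guesses,
    while completeness provides one execution. The frame condition for the latter comes from
    soundness. *)
Definition compile_sound k (f : mu_rec k) := forall (ins : k.-tuple nat) out fr s s',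
  regs_ok ins out fr -> s 0 = 0 -> exec (compile f ins out fr) s s' ->
  same_below fr out s s' /\ mu_eval f [tuple of map s ins] (s' out).

Definition compile_complete k (f : mu_rec k) := forall (ins : k.-tuple nat) out fr s y,
  regs_ok ins out fr -> s 0 = 0 -> mu_eval f [tuple of map s ins] y ->
  exists2 s', exec (compile f ins out fr) s s' & s' out = y.

Lemma map_same_below k (ins : k.-tuple nat) fr out (s s' : store) : regs_ok ins out fr ->
  same_below fr out s s' -> [tuple of map s' ins] = [tuple of map s ins].
Proof.
move=> [/allP lt no _ _] h; apply: val_inj; apply/eq_in_map => r hr /=.
by apply: h; [apply: lt|apply: contraNneq no => <-].
Qed.

Lemma thead_map_tuple k (ins : k.+1.-tuple nat) (s : store) :
  thead [tuple of map s ins] = s (thead ins).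
Proof. by rewrite /thead tnth_map. Qed.

(** The second conclusion is what the induction on [l] needs: a result already stored in [fr + i]
    survives the programs run after it. *)
Lemma exec_seqs_comp k m (hs : 'I_m -> mu_rec k) (ins : k.-tuple nat) out fr :
  (forall i, compile_sound (hs i)) -> regs_ok ins out fr ->
  forall l s s', uniq l -> s 0 = 0 ->
  exec (seqs [seq compile (hs i) ins (fr + i) (fr + m) | i <- l]) s s' ->
  [/\ forall r, r < fr -> s' r = s r,
      forall i : 'I_m, i \notin l -> s' (fr + i) = s (fr + i) &
      forall i : 'I_m, i \in l -> mu_eval (hs i) [tuple of map s ins] (s' (fr + i))].
Proof.
move=> hhs [lt no lto o0].
have ok (i : 'I_m) : regs_ok ins (fr + i) (fr + m).
  have im := ltn_ord i; split; [| |lia|lia].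
  - by apply: sub_all lt => r /= ?; lia.
  - by apply/negP => /(allP lt) /= ?; lia.
have nel (r : nat) (i : 'I_m) : r < fr -> r != fr + i by lia.
elim=> [|i l IH] s s' /=; first by move=> _ _ [_ ->]; split.
move=> /andP[il ul] s0 [s1 /(hhs _ _ _ _ _ _ (ok i) s0) [fr1 ev1]].
have s10 : s1 0 = 0 by rewrite fr1 //; lia.
move=> /(IH _ _ ul s10)[fr2 keep2 ev2]; split.
- by move=> r hr; rewrite fr2 // fr1 ?nel //; lia.
- move=> j; rewrite inE negb_or => /andP[ji jl].
  by rewrite keep2 // fr1 ?eqn_add2l // ltn_add2l.
- have -> : [tuple of map s ins] = [tuple of map s1 ins].
    by symmetry; apply: (@map_same_below _ _ fr out) => // r hr _; rewrite fr1 ?nel //; lia.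
  move=> j; rewrite inE; case: eqP => [-> _|_ /ev2//]; rewrite keep2 //.
  have -> // : [tuple of map s1 ins] = [tuple of map s ins].
  by apply: (@map_same_below _ _ fr out) => // r hr _; rewrite fr1 ?nel //; lia.
Qed.

Lemma exec_seqs_complete k m (hs : 'I_m -> mu_rec k) (ins : k.-tuple nat) out fr :
  (forall i, compile_sound (hs i)) -> (forall i, compile_complete (hs i)) ->
  regs_ok ins out fr -> forall (u : 'I_m -> nat) l s, uniq l -> s 0 = 0 ->
  (forall i, i \in l -> mu_eval (hs i) [tuple of map s ins] (u i)) ->
  exists s', exec (seqs [seq compile (hs i) ins (fr + i) (fr + m) | i <- l]) s s'.
Proof.
move=> hs1 hs2 rok u; have [lt no lto o0] := rok.
have ok (i : 'I_m) : regs_ok ins (fr + i) (fr + m).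
  have im := ltn_ord i; split; [| |lia|lia].
  - by apply: sub_all lt => r /= ?; lia.
  - by apply/negP => /(allP lt) /= ?; lia.
elim=> [|i l IH] s /=; first by exists s.
move=> /andP[il ul] s0 ev.
have [s1 h1 e1] := hs2 i _ _ _ _ _ (ok i) s0 (ev i (mem_head _ _)).
have [fr1 _] := hs1 i _ _ _ _ _ (ok i) s0 h1.
have fr1' r : r < fr -> s1 r = s r by move=> hr; rewrite fr1 //; lia.
have e : [tuple of map s1 ins] = [tuple of map s ins].
  by apply: (@map_same_below _ _ fr out) => // r hr _; rewrite fr1'.
have [||s2 h2] := IH s1 ul.
- by rewrite fr1' //; lia.
- by move=> j hj; rewrite e; apply: ev; rewrite inE hj orbT.
by exists s2; exists s1.
Qed.

Lemma copy_frame i j fr s s' : i != j -> fr <= j -> exec (copy i j) s s' ->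
  s' j = s i /\ forall r, r < fr -> s' r = s r.
Proof. by move=> ij frj /(copy_sound ij)[-> h]; split=> // r hr; apply: h; lia. Qed.

Lemma compile_comp_correct k m (g : mu_rec m) (hs : 'I_m -> mu_rec k) :
  compile_sound g /\ compile_complete g ->
  (forall i, compile_sound (hs i) /\ compile_complete (hs i)) ->
  compile_sound (MuComp g hs) /\ compile_complete (MuComp g hs).
Proof.
move=> [g1 g2] hhs.
have hs1 i := (hhs i).1; have hs2 i := (hhs i).2.
have okg (ins : k.-tuple nat) out fr : regs_ok ins out fr ->
    regs_ok [tuple fr + i | i < m] out (fr + m).
  move=> [lt no lto o0]; split; [| |lia|lia].
    by apply/allP => _ /mapP[i _ ->]; rewrite ltn_add2l.
  by apply/negP => /mapP[i _]; lia.
split=> ins out fr s.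
  move=> s' ok s0 /= [s1].
  move=> /(exec_seqs_comp hs1 ok (enum_uniq _) s0)[fr1 _ ev1].
  have [lt no lto o0] := ok.
  have s10 : s1 0 = 0 by rewrite fr1 //; lia.
  move=> /(g1 _ _ _ _ _ (okg _ _ _ ok) s10)[fr2 ev2]; split.
    by move=> r hr ro; rewrite fr2 ?fr1 //; lia.
  exists [tuple of map s1 [tuple fr + i | i < m]] => // i.
  by rewrite tnth_map tnth_mktuple; apply: ev1; rewrite mem_enum.
move=> y ok s0 /= [u hu gu].
have [|s1 h1] := exec_seqs_complete hs1 hs2 ok (u := tnth u) (enum_uniq 'I_m) s0.
  by move=> i _; apply: hu.
have [fr1 _ ev1] := exec_seqs_comp hs1 ok (enum_uniq _) s0 h1.
have [lt no lto o0] := ok.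
have s10 : s1 0 = 0 by rewrite fr1 //; lia.
(* The stored values are values of the [hs i]; they are those of [u] because [mu_eval] is
   functional. *)
have eu : u = [tuple of map s1 [tuple fr + i | i < m]].
  apply: eq_from_tnth => i; rewrite tnth_map tnth_mktuple.
  by apply: mu_eval_fun (hu i) (ev1 i _); rewrite mem_enum.
rewrite eu in gu; have [s2 h2 e2] := g2 _ _ _ _ _ (okg _ _ _ ok) s10 gu.
by exists s2 => //; exists s1.
Qed.

(** Register [fr] counts the iterations, [fr.+1] holds the current value and [fr.+2] receives the
    next one. The loop may be left at any time; the test of [fr] against the argument discards wrong
    numbers of iterations, and the invariant [inv] reads a derivation of [prim_rel] off [fr] and
    [fr.+1]. *)
Lemma compile_prim_correct k (g : mu_rec k) (h : mu_rec k.+2) :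
  compile_sound g /\ compile_complete g -> compile_sound h /\ compile_complete h ->
  compile_sound (MuPrim g h) /\ compile_complete (MuPrim g h).
Proof.
move=> [g1 g2] [h1 h2].
have okg (ins : k.+1.-tuple nat) out fr : regs_ok ins out fr ->
    regs_ok [tuple of behead ins] fr.+1 fr.+3.
  move=> [lt _ _ _].
  have lt' r : r \in behead ins -> r < fr by move=> /mem_behead /(allP lt).
  split; [| |lia|lia]; first by apply/allP => r /lt' ?; lia.
  by apply/negP => /lt' ?; lia.
have okh (ins : k.+1.-tuple nat) out fr : regs_ok ins out fr ->
    regs_ok [tuple of fr :: fr.+1 :: [tuple of behead ins]] fr.+2 fr.+3.
  move=> [lt _ _ _].
  have lt' r : r \in behead ins -> r < fr by move=> /mem_behead /(allP lt).
  split; [| |lia|lia] => /=.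
    by rewrite ltnS ltnW //= ltnS leqW //=; apply/allP => r /lt' ?; lia.
  by rewrite !inE; apply/negP => /or3P[/eqP|/eqP|/lt'] ?; lia.
pose inv (ins : k.+1.-tuple nat) fr s t :=
  (forall r, r < fr -> t r = s r) /\
  prim_rel (mu_eval g [tuple of behead [tuple of map s ins]])
    (fun n z => mu_eval h [tuple of n :: z :: [tuple of behead [tuple of map s ins]]])
    (t fr) (t fr.+1).
have map_inv (ins : k.+1.-tuple nat) out fr (s t : store) : regs_ok ins out fr ->
    (forall r, r < fr -> t r = s r) ->
    [tuple of map t [tuple of behead ins]] = [tuple of behead [tuple of map s ins]].
  move=> [lt _ _ _] e; apply: val_inj; rewrite /= behead_map; apply/eq_in_map => r /mem_behead hr.
  by rewrite e //; apply: (allP lt).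
have map3 (ins : k.+1.-tuple nat) out fr (s t : store) : regs_ok ins out fr ->
    (forall r, r < fr -> t r = s r) ->
    [tuple of map t [tuple of fr :: fr.+1 :: [tuple of behead ins]]] =
    [tuple of t fr :: t fr.+1 :: [tuple of behead [tuple of map s ins]]].
  by move=> ok e; rewrite -(map_inv _ _ _ _ _ ok e); apply: val_inj.
have fr0 (ins : k.+1.-tuple nat) out fr (s t : store) : regs_ok ins out fr -> s 0 = 0 ->
    (forall r, r < fr -> t r = s r) -> t 0 = 0.
  by move=> [_ _ lto o0] s0 ->; lia.
have body_inv (ins : k.+1.-tuple nat) out fr (s t t' : store) : regs_ok ins out fr -> s 0 = 0 ->
    inv ins fr s t ->
    exec (PSeq (compile h [tuple of fr :: fr.+1 :: [tuple of behead ins]] fr.+2 fr.+3)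
         (PSeq (copy fr.+2 fr.+1) (PInc fr))) t t' -> inv ins fr s t' /\ t' fr = (t fr).+1.
  move=> ok s0 [e pr] [t1 x1 [t2 x2 /= ->]].
  have [f1 ev1] := h1 _ _ _ _ _ (okh _ _ _ ok) (fr0 _ _ _ _ _ ok s0 e) x1.
  have [|e2 f2] := copy_sound _ x2; first by lia.
  rewrite (map3 _ _ _ _ _ ok e) in ev1.
  split; last by rewrite updE f2 1?f1 //; lia.
  split=> [r hr|].
    by rewrite updN ?f2 ?f1 ?e //; lia.
  rewrite updE updN ?e2; last by lia.
  rewrite f2 1?f1; try lia.
  by exists (t fr.+1).
split=> ins out fr s.
  move=> s' ok s0 /= [t1 x1 [t2 x2 [t3 x3 [t4 [e4 ->] x5]]]].
  have [lt no lto o0] := ok.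
  have [||e1 f1] := @copy_frame 0 fr fr _ _ _ _ x1; [lia|lia|].
  have [f2 ev2] := g1 _ _ _ _ _ (okg _ _ _ ok) (fr0 _ _ _ _ _ ok s0 f1) x2.
  have i2 : inv ins fr s t2.
    split; first by move=> r hr; rewrite f2 ?f1 //; lia.
    by rewrite f2 ?e1 ?s0 /= -?(map_inv _ _ _ _ _ ok f1) //; lia.
  have [f3 pr3] : inv ins fr s t3.
    apply: (star_inv (I := inv ins fr s) _ x3) => // x y ix /(body_inv _ _ _ _ _ _ ok s0 ix).
    by case.
  have [|e5 f5] := copy_sound _ x5; first by lia.
  split; first by move=> r hr ro; rewrite f5 ?f3 //; lia.
  have hin : thead ins < fr by apply: (allP lt); rewrite mem_tnth.
  by apply/mu_eval_prim; rewrite thead_map_tuple e5 -(f3 _ hin) -e4.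
move=> y ok s0 /mu_eval_prim; rewrite thead_map_tuple => pr.
have [lt no lto o0] := ok.
have [|t1 x1] := @copy_complete 0 fr s; first by lia.
have [||e1 f1] := @copy_frame 0 fr fr _ _ _ _ x1; [lia|lia|].
have loop n z : prim_rel (mu_eval g [tuple of behead [tuple of map s ins]])
    (fun n z => mu_eval h [tuple of n :: z :: [tuple of behead [tuple of map s ins]]]) n z ->
  exists t3, [/\ exec (compile g [tuple of behead ins] fr.+1 fr.+3) t1 t3 &
  exists t4, [/\ star (exec (PSeq
           (compile h [tuple of fr :: fr.+1 :: [tuple of behead ins]] fr.+2 fr.+3)
           (PSeq (copy fr.+2 fr.+1) (PInc fr)))) t3 t4, inv ins fr s t4, t4 fr = n & t4 fr.+1 = z]].
  elim: n z => [|n IH] z /=.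
    rewrite -(map_inv _ _ _ _ _ ok f1) => ev.
    have [t2 x2 e2] := g2 _ _ _ _ _ (okg _ _ _ ok) (fr0 _ _ _ _ _ ok s0 f1) ev.
    have [f2 _] := g1 _ _ _ _ _ (okg _ _ _ ok) (fr0 _ _ _ _ _ ok s0 f1) x2.
    have e2' : t2 fr = 0 by rewrite f2 ?e1 //; lia.
    exists t2; split=> //; exists t2; split=> //; first by left.
    split; first by move=> r hr; rewrite f2 ?f1 //; lia.
    by rewrite e2' /= e2 -(map_inv _ _ _ _ _ ok f1).
  move=> [z' /IH[t3 [x3 [t4 [x4 i4 en ez]]]] ev].
  exists t3; split=> //.
  have f4 := i4.1; have t40 := fr0 _ _ _ _ _ ok s0 f4.
  rewrite -en -ez -(map3 _ _ _ _ _ ok f4) in ev.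
  have [t5 x5 e5] := h2 _ _ _ _ _ (okh _ _ _ ok) t40 ev.
  have [|t6 x6] := @copy_complete fr.+2 fr.+1 t5; first by lia.
  have x7 : exec (PSeq (compile h [tuple of fr :: fr.+1 :: [tuple of behead ins]] fr.+2 fr.+3)
         (PSeq (copy fr.+2 fr.+1) (PInc fr))) t4 (upd t6 fr (t6 fr).+1).
    by exists t5 => //; exists t6.
  have [i7 e7] := body_inv _ _ _ _ _ _ ok s0 i4 x7.
  exists (upd t6 fr (t6 fr).+1); split=> //; last 2 first.
  - by rewrite e7 en.
  - have [|e6 _] := copy_sound _ x6; first by lia.
    by rewrite updN ?e6 ?e5 //; lia.
  (* [star] grows at the front, so the last iteration is appended by induction on the preceding
     ones. *)
  - elim: x4 x7 {i4 en ez f4 t40 ev x5 i7 e7} => [x x7|x' y' z'' R1 _ IH2 x7].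
      by apply: starS x7 _; left.
    by apply: starS R1 _; apply: IH2.
have [t3 [x3 [t4 [x4 [f4 _] en ez]]]] := loop _ _ pr.
have [|t5 x5] := @copy_complete fr.+1 out t4; first by lia.
have [|e5 _] := copy_sound _ x5; first by lia.
exists t5; last by rewrite e5.
exists t1 => //; exists t3 => //; exists t4 => //; exists t4 => //; split=> //.
by rewrite en f4 //; apply: (allP lt); rewrite mem_tnth.
Qed.

(** The guard of [PDec fr.+1] is the test that the value at the current candidate [fr] is nonzero.
    After the loop the body is run once more, and its value must be 0. *)
Lemma compile_min_correct k (g : mu_rec k.+1) :
  compile_sound g /\ compile_complete g ->
  compile_sound (MuMin g) /\ compile_complete (MuMin g).
Proof.
move=> [g1 g2].
have okg (ins : k.-tuple nat) out fr : regs_ok ins out fr ->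
    regs_ok [tuple of fr :: ins] fr.+1 fr.+2.
  move=> [lt _ _ _]; have lt' r : r \in val ins -> r < fr by move=> /(allP lt).
  split; [| |lia|lia] => /=.
    by rewrite ltnS ltnW //=; apply/allP => r /lt' ?; lia.
  by rewrite !inE; apply/negP => /orP[/eqP|/lt'] ?; lia.
have map_inv (ins : k.-tuple nat) out fr (s t : store) : regs_ok ins out fr ->
    (forall r, r < fr -> t r = s r) ->
    [tuple of map t [tuple of fr :: ins]] = [tuple of t fr :: [tuple of map s ins]].
  move=> [lt _ _ _] e; apply: val_inj; congr cons; apply/eq_in_map => r hr.
  by rewrite e //; apply: (allP lt).
have fr0 (ins : k.-tuple nat) out fr (s t : store) : regs_ok ins out fr -> s 0 = 0 ->
    (forall r, r < fr -> t r = s r) -> t 0 = 0.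
  by move=> [_ _ lto o0] s0 ->; lia.
split=> ins out fr s.
  move=> s' ok s0 [t1 x1 [t2 x2 [t3 x3 [t4 [e4 ->] x5]]]].
  have [lt no lto o0] := ok.
  have [||e1 f1] := @copy_frame 0 fr fr _ _ _ _ x1; [lia|lia|].
  have [f2 i2] : (forall r, r < fr -> t2 r = s r) /\
      forall j, j < t2 fr -> exists z, mu_eval g [tuple of j :: [tuple of map s ins]] z.+1.
    apply: (star_inv (I := fun t : store => (forall r, r < fr -> t r = s r) /\
      forall j, j < t fr -> exists z, mu_eval g [tuple of j :: [tuple of map s ins]] z.+1) _ x2);
      last by split=> //; rewrite e1 s0.
    move=> a b [fa ia] [c xc [d [ec ->] /= ->]].
    have [fc ev] := g1 _ _ _ _ _ (okg _ _ _ ok) (fr0 _ _ _ _ _ ok s0 fa) xc.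
    have cfr : c fr = a fr by rewrite fc //; lia.
    split=> [r hr|j]; first by rewrite !updN ?fc ?fa //; lia.
    rewrite updE updN ?cfr; last by lia.
    rewrite ltnS leq_eqVlt => /orP[/eqP->|]; last exact: ia.
    by exists (c fr.+1).-1; rewrite prednK // -(map_inv _ _ _ _ _ ok fa).
  have [f3 ev3] := g1 _ _ _ _ _ (okg _ _ _ ok) (fr0 _ _ _ _ _ ok s0 f2) x3.
  have [|e5 f5] := copy_sound _ x5; first by lia.
  have t3fr : t3 fr = t2 fr by rewrite f3 //; lia.
  split; first by move=> r hr ro; rewrite f5 ?f3 ?f2 //; lia.
  rewrite e5 t3fr /=; split=> //.
  rewrite -(map_inv _ _ _ _ _ ok f2).
  have t30 : t3 0 = 0 by rewrite f3 ?(fr0 _ _ _ _ _ ok s0 f2) //; lia.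
  by rewrite e4 t30 in ev3.
move=> y ok s0 /= [ev0 evS].
have [lt no lto o0] := ok.
have [|t1 x1] := @copy_complete 0 fr s; first by lia.
have [||e1 f1] := @copy_frame 0 fr fr _ _ _ _ x1; [lia|lia|].
set body := compile g [tuple of fr :: ins] fr.+1 fr.+2.
(* [n] is the number of candidates still to be rejected. *)
have loop n (t : store) : (forall r, r < fr -> t r = s r) -> t fr + n = y ->
    exists2 t', star (exec (PSeq body (PSeq (PDec fr.+1) (PInc fr)))) t t' &
      (forall r, r < fr -> t' r = s r) /\ t' fr = y.
  elim: n t => [|n IH] t ft ey.
    by exists t; [left|rewrite -ey addn0].
  have [|z ev] := evS (t fr); first by lia.
  rewrite -(map_inv _ _ _ _ _ ok ft) in ev.
  have [t2 x2 e2] := g2 _ _ _ _ _ (okg _ _ _ ok) (fr0 _ _ _ _ _ ok s0 ft) ev.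
  have [f2 _] := g1 _ _ _ _ _ (okg _ _ _ ok) (fr0 _ _ _ _ _ ok s0 ft) x2.
  have t2fr : t2 fr = t fr by rewrite f2 //; lia.
  pose t3 := upd t2 fr.+1 (t2 fr.+1).-1; pose t4 := upd t3 fr (t3 fr).+1.
  have [||t' x' h'] := IH t4.
  - by move=> r hr; rewrite /t4 /t3 !updN ?f2 ?ft //; lia.
  - by rewrite /t4 /t3 updE updN ?t2fr //; lia.
  exists t' => //; apply: starS x'; exists t2 => //; exists t3 => //.
  by split=> //; rewrite e2.
have [||t2 x2 [f2 e2]] := loop y t1; [exact: f1|by rewrite e1 s0|].
rewrite -e2 -(map_inv _ _ _ _ _ ok f2) in ev0.
have [t3 x3 e3] := g2 _ _ _ _ _ (okg _ _ _ ok) (fr0 _ _ _ _ _ ok s0 f2) ev0.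
have [f3 _] := g1 _ _ _ _ _ (okg _ _ _ ok) (fr0 _ _ _ _ _ ok s0 f2) x3.
have [|t4 x4] := @copy_complete fr out t3; first by lia.
have [|e4 _] := copy_sound _ x4; first by lia.
exists t4; last by rewrite e4 f3 ?e2 //; lia.
exists t1 => //; exists t2 => //; exists t3 => //; exists t3 => //; split=> //.
by rewrite e3 f3 ?(fr0 _ _ _ _ _ ok s0 f2) //; lia.
Qed.

Lemma compile_correct k (f : mu_rec k) : compile_sound f /\ compile_complete f.
Proof.
have cp k' (ins : k'.-tuple nat) out fr (i : nat) : regs_ok ins out fr ->
    i \in 0 :: val ins -> i != out.
  move=> [_ no _ o0]; rewrite inE => /orP[/eqP->|hi]; first by lia.
  by apply: contraNneq no => <-.
elim: f => {k} [k|| k i|k m g IHg hs IHhs|k g IHg h IHh|k g IHg].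
- split=> ins out fr s.
    move=> s' ok s0 /= /copy_sound[|e f]; first by apply: cp ok _; rewrite mem_head.
    by split=> [r _ /f|]; rewrite ?e.
  move=> y ok s0 /= ->.
  have n0 : 0 != out by apply: cp ok _; rewrite mem_head.
  by have [s' h] := copy_complete s n0; exists s' => //; rewrite (copy_sound n0 h).1.
- split=> ins out fr s.
    have hin : thead ins \in 0 :: val ins by rewrite inE mem_tnth orbT.
    move=> s' ok s0 /= [s1 /copy_sound[|e f ->]]; first exact: cp ok _.
    split=> [r _ ro|]; first by rewrite updN ?f.
    by rewrite /= updE e thead_map_tuple.
  move=> y ok s0 /= ->.
  have hin : thead ins \in 0 :: val ins by rewrite inE mem_tnth orbT.
  have n0 := cp _ _ _ _ _ ok hin; have [s' h] := copy_complete s n0.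
  exists (upd s' out (s' out).+1); first by exists s'.
  by rewrite updE (copy_sound n0 h).1 thead_map_tuple.
- split=> ins out fr s.
    have hin : tnth ins i \in 0 :: val ins by rewrite inE mem_tnth orbT.
    move=> s' ok s0 /= /copy_sound[|e f]; first exact: cp ok _.
    by split=> [r _ /f|]; rewrite ?e ?tnth_map.
  move=> y ok s0 /= ->.
  have hin : tnth ins i \in 0 :: val ins by rewrite inE mem_tnth orbT.
  have n0 := cp _ _ _ _ _ ok hin; have [s' h] := copy_complete s n0.
  by exists s' => //; rewrite (copy_sound n0 h).1 tnth_map.
- exact: compile_comp_correct.
- exact: compile_prim_correct.
- exact: compile_min_correct.
Qed.

(** * Runs as words of transitions *)

Lemma prog_comparable : comparable prog.
Proof. by move=> P Q; rewrite /decidable; do ![decide equality]. Qed.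
HB.instance Definition _ := hasDecEq.Build prog (compareP prog_comparable).

Inductive action := ANop | AInc of nat | ADec of nat | AEq of nat & nat.

Lemma action_comparable : comparable action.
Proof. by move=> a b; rewrite /decidable; do ![decide equality]. Qed.
HB.instance Definition _ := hasDecEq.Build action (compareP action_comparable).

Definition guard (a : action) (s : store) :=
  match a with
  | ADec r => 0 < s r
  | AEq i j => s i == s j
  | _ => true
  end.

Definition act (a : action) (s : store) : store :=
  match a with
  | AInc r => upd s r (s r).+1
  | ADec r => upd s r (s r).-1
  | _ => s
  end.

(* Control points are continuations: the list of programs that remain to be run. *)
Definition succs (K : seq prog) : seq (action * seq prog) :=
  match K with
  | [::] => [::]
  | PInc r :: K => [:: (AInc r, K)]
  | PDec r :: K => [:: (ADec r, K)]
  | PEq i j :: K => [:: (AEq i j, K)]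
  | PSeq P Q :: K => [:: (ANop, [:: P, Q & K])]
  | PStar P :: K => [:: (ANop, K); (ANop, [:: P, PStar P & K])]
  end.

(** A finite list of continuations containing [P :: K] and closed under successors up to [K] itself
    ([conts_closed]); it makes the set of transitions, hence the alphabet, finite. *)
Fixpoint conts (P : prog) (K : seq prog) : seq (seq prog) :=
  (P :: K) ::
  match P with
  | PSeq P Q => conts P (Q :: K) ++ conts Q K
  | PStar Q => conts Q (P :: K)
  | _ => [::]
  end.

Lemma mem_conts P K : P :: K \in conts P K.
Proof. by case: P => *; rewrite mem_head. Qed.

Lemma conts_closed P K K1 a K2 : K1 \in conts P K -> (a, K2) \in succs K1 ->
  (K2 \in conts P K) || (K2 == K).
Proof.
elim: P K K1 a K2 => [r|r|i j|P IHP Q IHQ|P IHP] K K1 a K2 /=.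
- by rewrite !inE => /eqP-> /=; rewrite inE => /eqP[_ ->]; rewrite eqxx orbT.
- by rewrite !inE => /eqP-> /=; rewrite inE => /eqP[_ ->]; rewrite eqxx orbT.
- by rewrite !inE => /eqP-> /=; rewrite inE => /eqP[_ ->]; rewrite eqxx orbT.
- rewrite inE mem_cat => /or3P[/eqP->|h1|h1] /=.
  + by rewrite !inE mem_cat => /eqP[_ ->]; rewrite mem_conts !orbT.
  + move=> /(IHP _ _ _ _ h1)/orP[h|/eqP->]; rewrite inE mem_cat ?h ?orbT //.
    by rewrite mem_conts !orbT.
  + by move=> /(IHQ _ _ _ _ h1)/orP[h|/eqP->]; rewrite inE mem_cat ?h ?eqxx ?orbT.
- rewrite inE => /orP[/eqP->|h1] /=.
  + by rewrite !inE => /orP[/eqP[_ ->]|/eqP[_ ->]]; rewrite ?eqxx ?mem_conts ?orbT.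
  + by move=> /(IHP _ _ _ _ h1)/orP[h|/eqP->]; rewrite inE ?h ?eqxx ?orbT.
Qed.

Definition letter := (seq prog * action * seq prog)%type.

Definition letters (P : prog) : seq letter :=
  [seq (K, b.1, b.2) | K <- conts P [::], b <- succs K].

Lemma mem_letters P K a K' : K \in conts P [::] -> (a, K') \in succs K ->
  (K, a, K') \in letters P.
Proof. by move=> hK hs; apply/allpairsPdep; exists K, (a, K'). Qed.

Lemma lettersP P l : l \in letters P -> (l.1.2, l.2) \in succs l.1.1.
Proof. by case/allpairsPdep=> K [[a K'] [_ h ->]]. Qed.

Section Paths.
Variables (P : prog) (s0 : store).

Inductive run : seq letter -> seq prog -> store -> Prop :=
| run0 : run [::] [:: P] s0
| runS u K a K' s of run u K s & (K, a, K') \in letters P & guard a s :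
    run (rcons u (K, a, K')) K' (act a s).

Fixpoint exec_cont (K : seq prog) (s s' : store) : Prop :=
  match K with
  | [::] => s = s'
  | Q :: K => exists2 s1, exec Q s s1 & exec_cont K s1 s'
  end.

Lemma exec_cont_step K a K' s t : (a, K') \in succs K -> guard a s ->
  exec_cont K' (act a s) t -> exec_cont K s t.
Proof.
case: K => [|[r|r|i j|Q Q'|Q] K] //=.
- by rewrite inE => /eqP[-> ->] _ h; exists (act (AInc r) s).
- by rewrite inE => /eqP[-> ->] g h; exists (act (ADec r) s).
- by rewrite inE => /eqP[-> ->] /eqP g h; exists s.
- by rewrite inE => /eqP[-> ->] _ [s1 h1 [s2 h2 h3]]; exists s2 => //; exists s1.
- rewrite !inE => /orP[/eqP[-> ->] _ h|/eqP[-> ->] _ [s1 h1 [s2 h2 h3]]].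
    by exists s => //; left.
  by exists s2 => //; apply: starS h2.
Qed.

Lemma run_sound u s : run u [::] s -> exec P s0 s.
Proof.
(* Generalised backwards: whatever the continuation at the end of a partial run can still do, the
   whole program can do from the start. *)
suff h v K t : run v K t -> forall t', exec_cont K t t' -> exec_cont [:: P] s0 t'.
  by move=> /h/(_ s erefl)[t ? /= <-].
elim=> {v K t} [//|v K a K' t _ IH /lettersP hs g t' ht].
by apply: IH; apply: exec_cont_step hs g ht.
Qed.

Lemma run_conts u K s : run u K s -> (K \in conts P [::]) || (K == [::]).
Proof.
elim=> {u K s} [|u K a K' s _ _ /allpairsPdep[K1 [[a1 K2] [h1 h2 [_ _ ->]]]] _].
  by rewrite mem_conts.
exact: conts_closed h1 h2.
Qed.

Lemma run_step u K s a K' : run u K s -> (a, K') \in succs K -> guard a s ->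
  exists u', run u' K' (act a s).
Proof.
move=> p hs g; exists (rcons u (K, a, K')); apply: runS => //.
have /orP[hK|/eqP e] := run_conts p; last by rewrite e in hs.
exact: mem_letters.
Qed.

Lemma run_complete_cont Q s s' : exec Q s s' ->
  forall u K, run u (Q :: K) s -> exists u', run u' K s'.
Proof.
elim: Q s s' => [r|r|i j|Q IHQ Q' IHQ'|Q IHQ] s s' /=.
- by move=> -> u K p; apply: (@run_step _ _ _ (AInc r) _ p); rewrite ?mem_head.
- by move=> [g ->] u K p; apply: (@run_step _ _ _ (ADec r) _ p); rewrite ?mem_head.
- move=> [g ->] u K p; apply: (@run_step _ _ _ (AEq i j) _ p); rewrite ?mem_head //.
  exact/eqP.
- move=> [s1 h1 h2] u K p.
  have [||u1 p1] := @run_step _ _ _ ANop [:: Q, Q' & K] p; rewrite ?mem_head //.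
  by have [u2 p2] := IHQ _ _ h1 _ _ p1; apply: IHQ' h2 _ _ p2.
- elim=> {s s'} [s|s s1 s' h1 _ IH] u K p.
    by apply: (@run_step _ _ _ ANop _ p); rewrite ?mem_head.
  have [||u1 p1] := @run_step _ _ _ ANop [:: Q, PStar Q & K] p.
  - by rewrite !inE eqxx orbT.
  - by [].
  by have [u2 p2] := IHQ _ _ h1 _ _ p1; apply: IH p2.
Qed.

Lemma run_complete s : exec P s0 s -> exists u, run u [::] s.
Proof. by move=> h; apply: run_complete_cont h _ _ run0. Qed.

End Paths.

Definition zero_store : store := fun=> 0.

(** The loop guesses the input in register 1, so that one program serves all inputs. The compiled
    code preserves this register, whose final value therefore tells which input was treated. *)
Definition main_prog (g : mu_rec 1) := PSeq (PStar (PInc 1)) (compile g [tuple 1] 2 3).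

Lemma main_progP (g : mu_rec 1) x :
  (exists u s, run (main_prog g) zero_store u [::] s /\ s 1 = x) <->
  (exists y, mu_eval g [tuple x] y).
Proof.
have ok : regs_ok [:: 1] 2 3 by [].
have tE (s : store) : [tuple of map s [tuple 1]] = [tuple s 1] by apply: val_inj.
split.
  move=> [u [s [/run_sound[s1 h1 h2] e]]].
  have s10 : s1 0 = 0.
    by apply: (star_inv (I := fun t : store => t 0 = 0) _ h1) => // a b + ->; rewrite updN.
  have [f ev] := (compile_correct g).1 _ _ _ _ _ ok s10 h2.
  by exists (s 2); rewrite -e (f 1) // -tE.
move=> [y ev].
have [s1 h1 [e1 s10]] : exists2 s1, star (exec (PInc 1)) zero_store s1 &
    s1 1 = x /\ s1 0 = 0.
  elim: x {ev} => [|x [s1 h1 [e1 e0]]]; first by exists zero_store => //; left.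
  exists (upd s1 1 x.+1); last by rewrite updE updN.
  elim: h1 e1 {e0} => [s <-|s s2 s3 R _ IH /IH h]; first by apply: starS (star0 _ _).
  exact: starS R h.
rewrite -e1 -tE in ev.
have [s2 h2 e2] := (compile_correct g).2 _ _ _ _ _ ok s10 ev.
have [f _] := (compile_correct g).1 _ _ _ _ _ ok s10 h2.
have [u p] := @run_complete (main_prog g) zero_store s2 (ex_intro2 _ _ s1 h1 h2).
by exists u, s2; rewrite (f 1).
Qed.

(** * Exact evaluation of integer networks *)

Import Order.TTheory GRing.Theory Num.Theory.
Local Open Scope ring_scope.

Definition exact_upto (A : fixed_width) (b B : nat) :=
  forall z : int, `|z| <= B%:Z -> exists x : fw_num A b, fw_val x = Some z%:~R.

Definition rep (A : fixed_width) b (x : fw_num A b) (z : int) := fw_val x = Some z%:~R.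

Section Representation.
Variables (A : fixed_width) (b B : nat).
Hypothesis hB : exact_upto A b B.

(** Rounding fixes representable numbers, so operations on integers are exact as long as the results
    stay within [B]. *)
Lemma rep_round z : `|z| <= B%:Z -> rep (@fw_round A b z%:~R) z.
Proof. by move=> /hB[x hx]; apply: fw_roundK hx. Qed.

Lemma rep_add (x y : fw_num A b) p q :
  rep x p -> rep y q -> `|p + q| <= B%:Z -> rep (fw_add x y) (p + q).
Proof. by move=> hx hy hpq; rewrite /rep (fw_addE hx hy) -intrD; apply: rep_round. Qed.

Lemma rep_mul (x y : fw_num A b) p q :
  rep x p -> rep y q -> `|p * q| <= B%:Z -> rep (fw_mul x y) (p * q).
Proof. by move=> hx hy hpq; rewrite /rep (fw_mulE hx hy) -intrM; apply: rep_round. Qed.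

Lemma rep_relu (x : fw_num A b) p :
  rep x p -> `|p| <= B%:Z -> rep (fw_relu x) (Num.max 0 p).
Proof.
move=> hx hp; rewrite /rep (fw_reluE hx).
have -> : Num.max 0 (p%:~R : rat) = (Num.max 0 p)%:~R.
  by case: (lerP 0 p) => h; [rewrite max_r ?ler0z|rewrite max_l // lerz0 ltW].
by apply: rep_round; lia.
Qed.

(** Bounding the sum of the absolute values bounds every partial sum, whatever cancellations
    occur. *)
Lemma rep_sum (I : Type) (r : seq I) (F : I -> fw_num A b) (f : I -> int) c z :
  (forall i, rep (F i) (f i)) -> rep c z -> `|z| + \sum_(i <- r) `|f i| <= B%:Z ->
  rep (\big[@fw_add A b/c]_(i <- r) F i) (\sum_(i <- r) f i + z).
Proof.
move=> hF hc; elim: r => [|i r IH]; first by rewrite !big_nil add0r.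
have := ler_norm_sum r f xpredT; rewrite !big_cons -addrA.
move: (\sum_(i <- r) `|f i|) (\sum_(i <- r) f i) IH => t u IH htu hb.
apply: rep_add => //; last by lia.
by apply: IH; lia.
Qed.

End Representation.

Definition dot F (w : seq (int * F)) (x : F -> int) : int := \sum_(p <- w) p.1 * x p.2.
Definition wnorm F (w : seq (int * F)) : int := \sum_(p <- w) `|p.1|.

(** Rows are lists of weighted named inputs, [din] and [dout] giving the names of the coordinates;
    the weights of a name listed several times add up. *)
Definition sparse_mx (F : eqType) G m n (din : 'I_m -> F) (dout : 'I_n -> G)
    (w : G -> seq (int * F)) : 'M[rat]_(n, m) :=
  \matrix_(i, j) (\sum_(p <- w (dout i) | p.2 == din j) p.1)%:~R.

Lemma sum_sparse (F : eqType) m (din : 'I_m -> F) (w : seq (int * F)) (f : int * F -> int) :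
  bijective din ->
  \sum_(j < m) \sum_(p <- w | p.2 == din j) f p = \sum_(p <- w) f p.
Proof.
move=> [dinv K1 K2]; rewrite (exchange_big_dep xpredT) //=; apply: eq_bigr => p _.
by rewrite (big_pred1 (dinv p.2)) // => j /=; rewrite -(can2_eq K1 K2) eq_sym.
Qed.

Lemma dot_sparse (F : eqType) m (din : 'I_m -> F) (w : seq (int * F)) (x : F -> int) :
  bijective din ->
  \sum_(j < m) (\sum_(p <- w | p.2 == din j) p.1) * x (din j) = dot w x.
Proof.
move=> bij; rewrite /dot -(sum_sparse _ (fun p => p.1 * x p.2) bij).
by apply: eq_bigr => j _; rewrite mulr_suml; apply: eq_bigr => p /eqP->.
Qed.

Lemma norm_dot F (w : seq (int * F)) x (b1 : nat) : (forall f, `|x f| <= b1%:Z) ->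
  `|dot w x| <= wnorm w * b1%:Z.
Proof.
move=> hx; rewrite /dot /wnorm mulr_suml; apply: le_trans (ler_norm_sum _ _ _) _.
by apply: ler_sum => p _; rewrite normrM ler_wpM2l.
Qed.

Definition reps A b n (G : Type) (d : 'I_n -> G) (X : 'cV[fw_arith A b]_n) (x : G -> int) :=
  forall i, rep (X i ord0 : fw_num A b) (x (d i)).

(** The last hypothesis bounds the products and partial sums; thanks to [0 < b1] it also bounds the
    entries of the matrix, which are themselves rounded. *)
Lemma rep_affine A b B (F : eqType) G m n (din : 'I_m -> F) (dout : 'I_n -> G) w
    (X : 'cV[fw_arith A b]_m) x (C : 'cV[fw_arith A b]_n) c (b1 : nat) :
  exact_upto A b B -> bijective din -> (0 < b1)%N ->
  reps din X x -> reps dout C c -> (forall f, `|x f| <= b1%:Z) ->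
  (forall g, `|c g| + wnorm (w g) * b1%:Z <= B%:Z) ->
  reps dout (affine (map_mx (@of_rat (fw_arith A b)) (sparse_mx din dout w)) C X)
    (fun g => dot (w g) x + c g).
Proof.
move=> hB bij b10 hX hC hx hb i; rewrite /affine mxE.
set M := fun j => \sum_(p <- w (dout i) | p.2 == din j) p.1.
have hM j : `|M j| <= \sum_(p <- w (dout i) | p.2 == din j) `|p.1| by apply: ler_norm_sum.
have w0 : 0 <= wnorm (w (dout i)) by apply: sumr_ge0.
have sM : \sum_(j < m) `|M j| <= wnorm (w (dout i)).
  by rewrite /wnorm -(sum_sparse _ (fun p => `|p.1|) bij); apply: ler_sum.
have hM1 j : `|M j| <= wnorm (w (dout i)).
  by apply: le_trans sM; rewrite (bigD1 j) //= lerDl sumr_ge0.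
have hMx j : `|M j * x (din j)| <= `|M j| * b1%:Z by rewrite normrM ler_wpM2l.
have hbi := hb (dout i).
have hle j : `|M j| * b1%:Z <= wnorm (w (dout i)) * b1%:Z by rewrite ler_wpM2r.
rewrite -(dot_sparse _ x bij); apply: (rep_sum (r := index_enum _) hB).
- move=> j; apply: (rep_mul hB) (hX j) _; last first.
    apply: le_trans (hMx j) _; apply: le_trans (hle j) _.
    by apply: le_trans hbi; rewrite lerDr.
  rewrite !mxE; apply: (rep_round hB (z := M j)); apply: le_trans (hM1 j) _.
  by move: (wnorm _) w0 hbi => u; move: (c _) => v; nia.
- exact: hC.
- apply: le_trans hbi; rewrite lerD2l; apply: le_trans (_ : (\sum_(j < m) `|M j|) * b1%:Z <= _).
    by rewrite mulr_suml; apply: ler_sum => j _; apply: hMx.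
  by rewrite ler_wpM2r.
Qed.

Definition node F := (seq (int * F) * int)%type.
Definition neval F (nd : node F) (x : F -> int) : int := dot nd.1 x + nd.2.

Definition sparse_layer (F : eqType) G m n (din : 'I_m -> F) (dout : 'I_n -> G)
    (nodes : G -> node F) : layer m n :=
  Layer (sparse_mx din dout (fun g => (nodes g).1)) (\col_i ((nodes (dout i)).2)%:~R).

(** A crude factor by which a layer can enlarge a positive bound on its inputs; the successor keeps
    it positive. *)
Definition layer_norm F (G : finType) (nodes : G -> node F) : nat :=
  (\sum_g absz (wnorm (nodes g).1 + `|(nodes g).2|)%R).+1.

Lemma layer_normP F (G : finType) (nodes : G -> node F) (b1 : nat) g : (0 < b1)%N ->
  `|(nodes g).2| + wnorm (nodes g).1 * b1%:Z <= (layer_norm nodes * b1)%N%:Z.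
Proof.
move=> b10.
have h : wnorm (nodes g).1 + `|(nodes g).2| <= (layer_norm nodes)%:Z.
  by rewrite /layer_norm (bigD1 g) //=; lia.
have w0 : 0 <= wnorm (nodes g).1 by apply: sumr_ge0.
by nia.
Qed.

Lemma rep_layer A b B (F : eqType) (G : finType) m n (din : 'I_m -> F) (dout : 'I_n -> G)
    (nodes : G -> node F) (X : 'cV[fw_arith A b]_m) x (b1 : nat) :
  exact_upto A b B -> bijective din -> (0 < b1)%N -> (layer_norm nodes * b1 <= B)%N ->
  reps din X x -> (forall f, `|x f| <= b1%:Z) ->
  reps dout (layer_affine (sparse_layer din dout nodes) X) (fun g => neval (nodes g) x).
Proof.
move=> hB bij b10 hb hX hx.
have hn g := layer_normP nodes g b10.
have w0 g : 0 <= wnorm (nodes g).1 by apply: sumr_ge0.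
apply: (rep_affine (w := fun g => (nodes g).1) hB bij b10 hX _ hx).
  by move=> i; rewrite !mxE; apply: (rep_round hB); have := hn (dout i); have := w0 (dout i); nia.
by move=> g; have := hn g; lia.
Qed.

Lemma norm_neval F (G : finType) (nodes : G -> node F) x (b1 : nat) g : (0 < b1)%N ->
  (forall f, `|x f| <= b1%:Z) -> `|neval (nodes g) x| <= (layer_norm nodes * b1)%N%:Z.
Proof.
move=> b10 hx; have := layer_normP nodes g b10; have := norm_dot (nodes g).1 hx.
by rewrite /neval; lia.
Qed.

Definition relu_layer F G (nodes : G -> node F) (x : F -> int) (g : G) : int :=
  Num.max 0 (neval (nodes g) x).

Lemma rep_relu_layer A b B (F : eqType) (G : finType) m n (din : 'I_m -> F) (dout : 'I_n -> G)
    (nodes : G -> node F) (X : 'cV[fw_arith A b]_m) x (b1 : nat) :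
  exact_upto A b B -> bijective din -> (0 < b1)%N -> (layer_norm nodes * b1 <= B)%N ->
  reps din X x -> (forall f, `|x f| <= b1%:Z) ->
  reps dout (map_mx (@frelu (fw_arith A b)) (layer_affine (sparse_layer din dout nodes) X))
    (relu_layer nodes x).
Proof.
move=> hB bij b10 hb hX hx i; rewrite mxE; apply: (rep_relu hB).
  exact: (@rep_layer _ _ _ _ _ _ _ _ dout _ _ _ _ hB bij b10 hb hX hx i).
by have := norm_neval nodes (dout i) b10 hx; lia.
Qed.

Lemma norm_relu_layer F (G : finType) (nodes : G -> node F) x (b1 : nat) g : (0 < b1)%N ->
  (forall f, `|x f| <= b1%:Z) -> `|relu_layer nodes x g| <= (layer_norm nodes * b1)%N%:Z.
Proof. by move=> b10 hx; have := norm_neval nodes g b10 hx; rewrite /relu_layer; lia. Qed.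

(** The single factor [k] measures both the room needed during the evaluation and the growth of the
    result, which makes networks compose. *)
Definition computes A n m F G (din : 'I_m -> F) (dout : 'I_n -> G) (N : net n m)
    (phi : (F -> int) -> G -> int) (k : nat) :=
  forall b B (b1 : nat) (X : 'cV[fw_arith A b]_m) x,
    exact_upto A b B -> (0 < b1)%N -> (k * b1 <= B)%N ->
    reps din X x -> (forall f, `|x f| <= b1%:Z) ->
    reps dout (fnn_eval N X) (phi x) /\ forall g, `|phi x g| <= (k * b1)%N%:Z.

Lemma computes_last A n m (F : eqType) (G : finType) (din : 'I_m -> F) (dout : 'I_n -> G)
    (nodes : G -> node F) : bijective din ->
  computes A din dout (NetLast (sparse_layer din dout nodes)) (relu_layer nodes)
    (layer_norm nodes).
Proof.
move=> bij b B b1 X x hB b10 hb hX hx; split; first exact: rep_relu_layer hB bij b10 hb hX hx.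
by move=> g; apply: norm_relu_layer.
Qed.

Lemma computes_cons A n m k (F H : eqType) (G : finType) (din : 'I_m -> F) (dmid : 'I_k -> G)
    (dout : 'I_n -> H) (nodes : G -> node F) (N : net n k) phi c : bijective din ->
  computes A dmid dout N phi c ->
  computes A din dout (NetCons (sparse_layer din dmid nodes) N)
    (fun x => phi (relu_layer nodes x)) (layer_norm nodes * c.+1).
Proof.
move=> bij hN b B b1 X x hB b10 hb hX hx.
(* The first summand is the room for the hidden layer, the second the room for the rest of the
   network. *)
have e : (layer_norm nodes * c.+1 * b1 = layer_norm nodes * b1 + c * (layer_norm nodes * b1))%N.
  by rewrite mulnS mulnDl; congr addn; rewrite mulnAC mulnC.
have [||||r1 r2] := hN b B (layer_norm nodes * b1)%N (map_mx (@frelu _)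
  (layer_affine (sparse_layer din dmid nodes) X)) (relu_layer nodes x) hB.
- by rewrite muln_gt0 b10 andbT.
- by lia.
- by apply: rep_relu_layer hB bij b10 _ hX hx; lia.
- by move=> g; apply: norm_relu_layer.
- by split=> [|g]; [exact: r1|have := r2 g; lia].
Qed.

(** * Layers computing prefix sums *)

(** [scanl] omits its initial value, so these are the nonempty prefixes, one for each position. *)
Definition prefixes T (w : seq T) := scanl (@rcons T) [::] w.

Lemma prefixes_rcons T (w : seq T) a : prefixes (rcons w a) = rcons (prefixes w) (rcons w a).
Proof.
rewrite /prefixes scanl_rcons; congr rcons.
suff h u v : foldl (@rcons T) u v = u ++ v by rewrite h.
by elim: v u => [|c v IH] u /=; rewrite ?cats0 ?IH ?cat_rcons.
Qed.

(* All sequences of vectors computed by a model are indexed by the prefixes of the input word. *)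
Definition lift_layer (A : arith) T d (l : ssm_layer d) (X : seq T -> 'cV[A]_d) (u : seq T) :=
  fnn_eval (phi l) (col_mx
    (foldl (ssm_step l) (map_mx (@of_rat A) (h0 l)) (map X (prefixes u))) (X u)).

Lemma ssm_layer_eval_prefixes (A : arith) T d (l : ssm_layer d) (X : seq T -> 'cV[A]_d) w :
  ssm_layer_eval l (map X (prefixes w)) = map (lift_layer l X) (prefixes w).
Proof.
elim/last_ind: w => [//|w a IH]; rewrite prefixes_rcons !map_rcons -IH.
rewrite /ssm_layer_eval /ssm_states scanl_rcons zip_rcons ?map_rcons.
  by rewrite /lift_layer prefixes_rcons map_rcons.
by rewrite size_scanl.
Qed.

Lemma ssm_layers_prefixes (A : arith) T d (ls : seq (ssm_layer d)) (X : seq T -> 'cV[A]_d) w :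
  foldl (fun xs l => ssm_layer_eval l xs) (map X (prefixes w)) ls =
  map (foldl (fun X l => lift_layer l X) X ls) (prefixes w).
Proof. by elim: ls X => //= l ls IH X; rewrite ssm_layer_eval_prefixes IH. Qed.

Definition last_emb (A : arith) (S : ssm) (u : seq 'I_(asize S)) : 'cV[A]_(Defs.dim S) :=
  last (map_mx (@of_rat A) 0) [seq map_mx (@of_rat A) (emb S a) | a <- u].

Lemma ssm_eval_rcons (A : arith) (S : ssm) w a :
  @ssm_eval A S (rcons w a) = Some (fnn_eval (out S)
    (foldl (fun X l => lift_layer l X) (@last_emb A S) (layers S) (rcons w a)) ord0 ord0).
Proof.
rewrite /ssm_eval.
have e v : [seq map_mx (@of_rat A) (emb S a) | a <- v] = map (@last_emb A S) (prefixes v).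
  elim/last_ind: v => [//|v c IH]; rewrite prefixes_rcons !map_rcons IH.
  by rewrite /last_emb map_rcons last_rcons.
by rewrite e ssm_layers_prefixes prefixes_rcons map_rcons rev_rcons.
Qed.

Section PrefixSums.
Variable F : finType.
Implicit Type A : fixed_width.

Definition dec1 : 'I_#|F| -> F := fun i => enum_val i.
Definition dec2 (i : 'I_(#|F| + #|F|)) : F + F :=
  match split i with inl j => inl (dec1 j) | inr j => inr (dec1 j) end.

Lemma dec1_bij : bijective dec1. Proof. exact: enum_val_bij. Qed.

Lemma dec2_bij : bijective dec2.
Proof.
exists (fun s => match s with
  | inl f => lshift _ (enum_rank f)
  | inr f => rshift _ (enum_rank f)
  end).
  by move=> i; rewrite /dec2; case: splitP => j e; apply: val_inj; rewrite /= /dec1 enum_valK.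
case=> f; rewrite /dec2.
  by rewrite [split _](unsplitK (inl (enum_rank f))) /dec1 enum_rankK.
by rewrite [split _](unsplitK (inr (enum_rank f))) /dec1 enum_rankK.
Qed.

Definition id_nodes (f : F) : node F := ([:: (1, f)], 0).

Definition sum_layer (N : net #|F| (#|F| + #|F|)) : ssm_layer #|F| :=
  SSMLayer 0 (GateConst 1%:M) (NetLast (sparse_layer dec1 dec1 id_nodes)) N.

Definition psum T (X : seq T -> F -> int) (u : seq T) (f : F) : int :=
  \sum_(v <- prefixes u) X v f.

Lemma psum_rcons T (X : seq T -> F -> int) u a f :
  psum X (rcons u a) f = psum X u f + X (rcons u a) f.
Proof. by rewrite /psum prefixes_rcons -cats1 big_cat big_seq1. Qed.

Lemma psum_nil T (X : seq T -> F -> int) f : psum X [::] f = 0.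
Proof. exact: big_nil. Qed.

Definition sum_and_value T (X : seq T -> F -> int) u (s : F + F) : int :=
  match s with inl f => psum X u f | inr f => X u f end.

Lemma norm_psum T (X : seq T -> F -> int) n (b1 : nat) u f :
  (forall u f, (0 < size u <= n)%N -> `|X u f| <= b1%:Z) -> (size u <= n)%N ->
  `|psum X u f| <= (size u * b1)%N%:Z.
Proof.
move=> hX; elim/last_ind: u => [|u a IH]; first by rewrite psum_nil.
rewrite psum_rcons size_rcons => hs; have := IH (ltnW hs).
by have := hX (rcons u a) f; rewrite size_rcons => /(_ hs); rewrite mulSn; lia.
Qed.

Lemma sparse_mx_id : sparse_mx dec1 dec1 (fun f => (id_nodes f).1) = 1%:M.
Proof.
apply/matrixP=> i j; rewrite !mxE big_cons big_nil /= (bij_eq dec1_bij).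
by case: eqP.
Qed.

(** Room for one update of the state: the first term is for the increment network, and 2 for the
    previous sum plus the new input. *)
Definition state_norm : nat := (layer_norm id_nodes + 2)%N.

(** Prefix sums multiply a bound by the length [n], so each use costs a factor [n]. This cannot be
    iterated over the repeated layer, for which [norm_xD] gives a bound independent of the number of
    copies. *)
Lemma rep_lift_layer A b B T (N : net #|F| (#|F| + #|F|)) phi k n (b1 : nat)
    (X : seq T -> 'cV[fw_arith A b]_#|F|) x :
  exact_upto A b B -> computes A dec2 dec1 N phi k -> (0 < b1)%N ->
  ((k + state_norm) * (n * b1) <= B)%N ->
  (forall u, (0 < size u <= n)%N -> reps dec1 (X u) (x u)) ->
  (forall u f, (0 < size u <= n)%N -> `|x u f| <= b1%:Z) ->
  forall u, (0 < size u <= n)%N ->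
  reps dec1 (lift_layer (sum_layer N) X u) (phi (sum_and_value x u)) /\
  forall f, `|phi (sum_and_value x u) f| <= (k * (n * b1))%N%:Z.
Proof.
move=> hB hN b10 hb hX hx u hu.
have n0 : (0 < n)%N by lia.
have nb : (b1 <= n * b1)%N by rewrite leq_pmull.
have hsum v f : (size v <= n)%N -> `|psum x v f| <= (n * b1)%N%:Z.
  move=> hv; apply: le_trans (norm_psum f hx hv) _.
  by rewrite lez_nat leq_mul2r hv orbT.
have hst v : (size v <= n)%N ->
    reps dec1 (foldl (ssm_step (sum_layer N)) (map_mx (@of_rat (fw_arith A b)) 0)
      (map X (prefixes v))) (psum x v).
  elim/last_ind: v => [_ i|v a IH].
    rewrite !mxE psum_nil; apply: (rep_round hB (z := 0)); lia.
  rewrite size_rcons => hv; have hv' : (0 < size (rcons v a) <= n)%N by rewrite size_rcons.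
  rewrite prefixes_rcons map_rcons foldl_rcons.
  (* The identity gate is seen as a sparse matrix, so that [rep_affine] covers the update. *)
  move: (foldl _ _ _) (IH (ltnW hv)) => H rH; rewrite /ssm_step /gate_eval /= -sparse_mx_id.
  have hl : (layer_norm id_nodes * b1 <= B)%N by rewrite /state_norm in hb; nia.
  have r1 : reps dec1 (pwl_eval (NetLast (sparse_layer dec1 dec1 id_nodes)) (X (rcons v a)))
      (fun g => neval (id_nodes g) (x (rcons v a))).
    move=> i; rewrite mxE.
    exact: (@rep_layer _ _ _ _ _ _ _ _ dec1 id_nodes _ _ _ hB dec1_bij b10 hl (hX _ hv')
      (fun f => hx _ f hv') i).
  have idE f y : neval (id_nodes f) y = y f.
    by rewrite /neval /dot /= big_cons big_nil mul1r !addr0.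
  have nb0 : (0 < n * b1)%N by lia.
  have hw f : `|neval (id_nodes f) (x (rcons v a))| +
      wnorm (id_nodes f).1 * (n * b1)%N%:Z <= B%:Z.
    rewrite idE /wnorm /= big_cons big_nil addr0 normr1 mul1r; have := hx _ f hv'.
    have : (2 * (n * b1) <= B)%N.
      by apply: leq_trans hb; rewrite leq_mul2r /state_norm; apply/orP; right; lia.
    by move: (n * b1)%N nb => m nb; lia.
  have r2 := rep_affine hB dec1_bij nb0 rH r1 (fun f => hsum v f (ltnW hv)) hw.
  move=> i; rewrite psum_rcons; have := r2 i.
  rewrite idE; have := idE (dec1 i) (psum x v); rewrite /neval addr0 => -> h; exact: h.
apply: hN hB _ _ _ _.
- by lia.
- by nia.
- have hu' : (size u <= n)%N by lia.
  move=> i; rewrite /dec2; case: (splitP i) => j e.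
    by have -> : i = lshift _ j by [apply: val_inj]; rewrite col_mxEu; apply: hst.
  by have -> : i = rshift _ j by [apply: val_inj]; rewrite col_mxEd; apply: hX.
- case=> f /=; first by apply: hsum; lia.
  by apply: le_trans (hx _ f hu) _; rewrite lez_nat.
Qed.

End PrefixSums.

(** * Checking runs *)

Lemma action_eqE :
  ((forall r i, (AInc r == AInc i) = (r == i)) *
   (forall r i, (ADec r == ADec i) = (r == i)) *
   (forall i, (ANop == AInc i) = false) * (forall i, (ANop == ADec i) = false) *
   (forall r i, (AInc r == ADec i) = false) * (forall r i, (ADec r == AInc i) = false) *
   (forall j k i, (AEq j k == AInc i) = false) * (forall j k i, (AEq j k == ADec i) = false))%type.
Proof. by do ![split] => *; first [by apply/eqP/eqP => [[]|->] | by apply/negbTE/eqP]. Qed.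

Section Checker.
Variables (M qF N : nat) (lab : 'I_N -> nat * action * nat).
(** This provides for the registers up to [M] and, in any case, for the input register 1. *)
Local Notation m := M.+2.

Definition src (a : 'I_N) : nat := (lab a).1.1.
Definition lact (a : 'I_N) : action := (lab a).1.2.
Definition tgt (a : 'I_N) : nat := (lab a).2.

Definition feature := option (option (option ('I_m + 'I_m + 'I_m * 'I_m))).
Definition fV : feature := None.
Definition fSrc : feature := Some None.
Definition fTgt : feature := Some (Some None).
Definition fInc (i : 'I_m) : feature := Some (Some (Some (inl (inl i)))).
Definition fDec (i : 'I_m) : feature := Some (Some (Some (inl (inr i)))).
Definition fTst (i j : 'I_m) : feature := Some (Some (Some (inr (i, j)))).

(** Equality tests are marked in both orders: each order is checked as an inequality. *)
Definition feat (a : 'I_N) (f : feature) : nat :=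
  match f with
  | None => 0
  | Some None => src a
  | Some (Some None) => tgt a
  | Some (Some (Some (inl (inl i)))) => lact a == AInc i
  | Some (Some (Some (inl (inr i)))) => lact a == ADec i
  | Some (Some (Some (inr (i, j)))) => (lact a == AEq i j) || (lact a == AEq j i)
  end.

Definition reg1 : 'I_m := lift ord0 ord0.

(* The networks D, C, A, O: the repeated layer, the checks on a transition, the sum of the
   violations, and the output.  In D, [fV] is the clipped coordinate. *)
Definition dHid (h : option feature) : node (feature + feature) :=
  match h with
  | Some f => ([:: (1, inr f)], 0)
  | None => ([:: (1, inr fV); (-1, inl (fInc reg1)); (1, inl (fDec reg1))], 0)
  end.
Definition dOut (f : feature) : node (option feature) :=
  match f with
  | None => ([:: (1, Some fV); (-1, None)], 1)
  | f => ([:: (1, Some f)], 0)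
  end.
Definition phiD x := relu_layer dOut (relu_layer dHid x).

(** With [v] the clipped coordinate and [c >= 0] the input register, the result is [v + 1] while
    [v <= c] and [c + 1] from then on. *)
Lemma phiD_V x : 0 <= x (inr fV) -> phiD x None =
  Num.max 0 (x (inr fV) + 1 - Num.max 0 (x (inr fV) - (x (inl (fInc reg1)) - x (inl (fDec reg1))))).
Proof. by rewrite /phiD /relu_layer /neval /dot /= !big_cons !big_nil /=; lia. Qed.

Lemma phiD_S x f : 0 <= x (inr (Some f : feature)) -> phiD x (Some f) = x (inr (Some f : feature)).
Proof. by rewrite /phiD /relu_layer /neval /dot /= !big_cons !big_nil /=; lia. Qed.

Definition sgnb (c : bool) : int := if c then 1 else -1.
(** In [inl (c, t)], [c] is one of the two signs with which an equation is tested: [None] for the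
    chaining of transitions, [Some false] for the clipped coordinate against the input register,
    [Some true] for the final control point. *)
Definition hid1 := ((bool * option bool) + ('I_m + 'I_m * 'I_m * option bool))%type.
Definition hid2 := ((bool * option bool) + ('I_m + 'I_m * 'I_m))%type.

Definition cHid1 (h : hid1) : node (feature + feature) :=
  match h with
  | inl (c, None) =>
      ([:: (sgnb c, inl fTgt); (- sgnb c, inl fSrc); (- sgnb c, inr fTgt)], 0)
  | inl (c, Some false) =>
      ([:: (sgnb c, inr fV); (- sgnb c, inl (fInc reg1)); (sgnb c, inl (fDec reg1))], 0)
  | inl (c, Some true) => ([:: (sgnb c, inr fTgt)], - sgnb c * qF%:Z)
  | inr (inl i) => ([:: (-1, inl (fInc i)); (1, inl (fDec i))], 0)
  | inr (inr ((i, j), None)) => ([:: (1, inr (fTst i j))], 0)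
  | inr (inr ((i, j), Some c)) =>
      ([:: (1, inl (fInc i)); (-1, inl (fDec i)); (-1, inl (fInc j)); (1, inl (fDec j))],
       if c then -1 else 0)
  end.

(* [min (1, max (0, c))] is the difference of the units [c] and [c - 1], so that the unit for
   a pair [p] is 1 if the test [p] is requested and fails, and 0 otherwise. *)
Definition cHid2 (h : hid2) : node hid1 :=
  match h with
  | inl p => ([:: (1, inl p)], 0)
  | inr (inl i) => ([:: (1, inr (inl i))], 0)
  | inr (inr p) => ([:: (1, inr (inr (p, Some false))); (-1, inr (inr (p, Some true)));
                        (1, inr (inr (p, None)))], -1)
  end.

Definition stepwise (h : hid2) : bool := if h is inl (_, Some _) then false else true.

(* From here on, [fV] holds the violations at the current position and [fSrc] those of the
   conditions that matter only at the last position. *)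
Definition cOut (f : feature) : node hid2 :=
  match f with
  | None => ([seq (1, h) | h <- enum stepwise], 0)
  | Some None => ([seq (1, h) | h <- enum (predC stepwise)], 0)
  | _ => ([::], 0)
  end.
Definition phiC x := relu_layer cOut (relu_layer cHid2 (relu_layer cHid1 x)).

Lemma relu_layer_ge0 F G (nodes : G -> node F) x g : 0 <= relu_layer nodes x g.
Proof. by rewrite /relu_layer; lia. Qed.

Lemma relu_sum_eq0 (G : finType) (P : pred G) (x : G -> int) : (forall g, 0 <= x g) ->
  Num.max 0 (neval ([seq (1, h) | h <- enum P], 0) x) = 0 <-> forall g, P g -> x g = 0.
Proof.
move=> x0; rewrite /neval /dot /= addr0 big_map big_enum /=.
under eq_bigr do rewrite mul1r.
have s0 : 0 <= \sum_(g in P) x g by apply: sumr_ge0.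
have -> : Num.max 0 (\sum_(g in P) x g) = \sum_(g in P) x g by rewrite max_r.
split=> [/eqP|h]; last by apply: big1 => g /h.
by rewrite psumr_eq0 // => /allP h g Pg; apply/eqP/(implyP (h g (mem_index_enum g))).
Qed.

Lemma phiC_V x : (forall i j, 0 <= x (inr (fTst i j)) <= 1) ->
  phiC x fV = 0 <->
  [/\ x (inl fTgt) - x (inl fSrc) = x (inr fTgt),
      forall i, x (inl (fDec i)) <= x (inl (fInc i)) &
      forall i j, x (inr (fTst i j)) = 1 ->
        x (inl (fInc i)) - x (inl (fDec i)) <= x (inl (fInc j)) - x (inl (fDec j))].
Proof.
move=> hT; rewrite /phiC {1}/relu_layer /cOut /=.
rewrite relu_sum_eq0; last by move=> g; apply: relu_layer_ge0.
split=> [h|[h1 h2 h3] g].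
  split=> [|i|i j].
  - have := h (inl (true, None)) isT; have := h (inl (false, None)) isT.
    by rewrite /relu_layer /neval /dot /= !big_cons !big_nil /=; lia.
  - have := h (inr (inl i)) isT.
    by rewrite /relu_layer /neval /dot /= !big_cons !big_nil /=; lia.
  - have := h (inr (inr (i, j))) isT.
    by rewrite /relu_layer /neval /dot /= !big_cons !big_nil /=; lia.
case: g => [[[] []]//|[i|[i j]]] _.
- by rewrite /relu_layer /neval /dot /= !big_cons !big_nil /=; lia.
- by rewrite /relu_layer /neval /dot /= !big_cons !big_nil /=; lia.
- by have := h2 i; rewrite /relu_layer /neval /dot /= !big_cons !big_nil /=; lia.
- have := h3 i j; have := hT i j.
  by rewrite /relu_layer /neval /dot /= !big_cons !big_nil /=; lia.
Qed.

Lemma phiC_Src x : phiC x fSrc = 0 <->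
  x (inr fV) = x (inl (fInc reg1)) - x (inl (fDec reg1)) /\ x (inr fTgt) = qF%:Z.
Proof.
rewrite /phiC {1}/relu_layer /cOut /=.
rewrite relu_sum_eq0; last by move=> g; apply: relu_layer_ge0.
split=> [h|[h1 h2] g].
  have := h (inl (true, Some true)) isT; have := h (inl (false, Some true)) isT.
  have := h (inl (true, Some false)) isT; have := h (inl (false, Some false)) isT.
  by rewrite /relu_layer /neval /dot /= !big_cons !big_nil /=; lia.
case: g => [[[] [[]|]]|]// _;
  by rewrite /relu_layer /neval /dot /= !big_cons !big_nil /=; lia.
Qed.

Definition aOut (f : feature) : node (feature + feature) :=
  match f with
  | None => ([:: (1, inl fV); (1, inr fSrc)], 0)
  | _ => ([::], 0)
  end.
Definition phiA := relu_layer aOut.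

Lemma phiA_V x : 0 <= x (inl fV) -> 0 <= x (inr fSrc) ->
  phiA x fV = x (inl fV) + x (inr fSrc).
Proof. by rewrite /phiA /relu_layer /neval /dot /= !big_cons !big_nil /=; lia. Qed.

Definition oOut (_ : unit) : node feature := ([:: (-1, fV)], 1).
Definition phiO := relu_layer oOut.

Lemma phiO_eq1 x : 0 <= x fV -> phiO x tt = 1 <-> x fV = 0.
Proof. by rewrite /phiO /relu_layer /neval /dot /= !big_cons !big_nil /=; lia. Qed.

(** * Values along a word and correctness of the checks *)

Definition x0 (u : seq 'I_N) (f : feature) : int := last 0 [seq (feat a f)%:Z | a <- u].
Definition xD n := iter n (fun x u => phiD (sum_and_value x u)) x0.
Definition xC n u := phiC (sum_and_value (xD n) u).
Definition xA n u := phiA (sum_and_value (xC n) u).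

Definition ftotal (u : seq 'I_N) f : int := \sum_(a <- u) (feat a f)%:Z.
Definition counter u i : int := ftotal u (fInc i) - ftotal u (fDec i).

Lemma ftotal_rcons u a f : ftotal (rcons u a) f = ftotal u f + (feat a f)%:Z.
Proof. by rewrite /ftotal -cats1 big_cat big_seq1. Qed.

Lemma ftotal_nil f : ftotal [::] f = 0. Proof. exact: big_nil. Qed.

Lemma xD_S n u a f : xD n (rcons u a) (Some f) = (feat a (Some f))%:Z.
Proof.
elim: n => [|n IH]; first by rewrite /xD /x0 /= map_rcons last_rcons.
by rewrite {1}/xD iterS -/(xD n) phiD_S /= IH.
Qed.

Lemma psum_xD n u f : psum (xD n) u (Some f) = ftotal u (Some f).
Proof.
elim/last_ind: u => [|u a IH]; first by rewrite psum_nil ftotal_nil.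
by rewrite psum_rcons ftotal_rcons IH xD_S.
Qed.

Fixpoint clip n (c : int) : int :=
  if n is n'.+1 then Num.max 0 (clip n' c + 1 - Num.max 0 (clip n' c - c)) else 0.

(** Uniform in [n] and valid for negative [c], since words that are not runs must be evaluated
    exactly too. *)
Lemma clip_bound n c : 0 <= clip n c <= `|c| + 1.
Proof. by elim: n => [|n IH] /=; lia. Qed.

Lemma clip_ge0 n c : 0 <= c -> clip n c = Num.min n%:Z (c + 1).
Proof. by move=> c0; elim: n => [|n IH] /=; lia. Qed.

Lemma xD_V n u a : xD n (rcons u a) fV = clip n (counter (rcons u a) reg1).
Proof.
elim: n => [|n IH]; first by rewrite /xD /x0 /= map_rcons last_rcons.
rewrite {1}/xD iterS -/(xD n) phiD_V /=; rewrite IH.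
  by rewrite !psum_xD.
by have := clip_bound n (counter (rcons u a) reg1); lia.
Qed.

Lemma xC_ge0 n u f : 0 <= xC n u f. Proof. exact: relu_layer_ge0. Qed.

Lemma psum_xC_ge0 n u f : 0 <= psum (xC n) u f.
Proof. by apply: sumr_ge0 => v _; apply: xC_ge0. Qed.

(** All conditions are read after the transition: a decrement is legal iff the new counter is
    nonnegative, and tests leave the counters unchanged. At the first position the chaining equation
    forces the source to be 0, the number of the initial point. *)
Lemma xC_V n u a : xC n (rcons u a) fV = 0 <->
  [/\ ftotal (rcons u a) fTgt - ftotal (rcons u a) fSrc = (tgt a)%:Z,
      forall i, 0 <= counter (rcons u a) i &
      forall i j : 'I_m, (lact a == AEq i j) || (lact a == AEq j i) ->
        counter (rcons u a) i <= counter (rcons u a) j].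
Proof.
rewrite /xC phiC_V => [|i j]; last by rewrite /= xD_S /=; case: (_ || _).
rewrite /= !psum_xD xD_S; split=> -[h1 h2 h3]; split=> //.
- by move=> i; have := h2 i; rewrite !psum_xD /counter subr_ge0.
- by move=> i j hT; have := h3 i j; rewrite !psum_xD xD_S /= hT; apply.
- by move=> i; have := h2 i; rewrite !psum_xD /counter subr_ge0.
- move=> i j; rewrite !psum_xD xD_S /= => hT; apply: h3.
  by case: (_ || _) hT.
Qed.

Lemma xC_Src n u a : xC n (rcons u a) fSrc = 0 <->
  clip n (counter (rcons u a) reg1) = counter (rcons u a) reg1 /\ tgt a = qF.
Proof.
rewrite /xC phiC_Src /= xD_V !psum_xD xD_S -/(counter _ _) /=.
by split=> -[-> h]; split=> //; [case: h|rewrite h].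
Qed.

Inductive nrun : seq 'I_N -> nat -> store -> Prop :=
| nrun0 : nrun [::] 0 zero_store
| nrunS u a s of nrun u (src a) s & guard (lact a) s :
    nrun (rcons u a) (tgt a) (act (lact a) s).

Lemma counter_step u a (s : store) : guard (lact a) s ->
  (forall i : 'I_m, counter u i = (s i)%:Z) ->
  forall i : 'I_m, counter (rcons u a) i = (act (lact a) s i)%:Z.
Proof.
move=> g h i; have := h i; rewrite /counter !ftotal_rcons /=.
case: (lact a) g => [|r|r|j k] /= g e; rewrite !action_eqE; try by lia.
  by rewrite /upd [nat_of_ord i == r]eq_sym; case: eqP => [->|_]; lia.
by move: e; rewrite /upd [nat_of_ord i == r]eq_sym; case: eqP => [<-|_]; lia.
Qed.

Lemma nrun_ftotal u q s : nrun u q s ->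
  ftotal u fTgt - ftotal u fSrc = q%:Z /\ forall i : 'I_m, counter u i = (s i)%:Z.
Proof.
elim=> {u q s} [|u a s _ [IH1 IH2] g].
  by split=> [|i]; rewrite /counter !ftotal_nil.
by split; [rewrite !ftotal_rcons /=; lia|apply: counter_step].
Qed.

Lemma nrun_correct n u q s : nrun u q s -> psum (xC n) u fV = 0.
Proof.
elim=> {u q s} [|u a s r IH g]; first exact: psum_nil.
have [h1 h2] := nrun_ftotal (nrunS r g); have [_ h2'] := nrun_ftotal r.
rewrite psum_rcons IH add0r; apply/xC_V; split=> //; first by move=> i; rewrite h2.
move=> i j; rewrite !h2 => /orP[]/eqP e; move: g; rewrite e /= => /eqP->//.
Qed.

Definition act_below (a : action) :=
  match a with
  | ANop => true
  | AInc r | ADec r => (r < m)%N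
  | AEq i j => (i < m)%N && (j < m)%N
  end.

(** Violations are nonnegative, so a vanishing total vanishes on every prefix, and the run is built
    letter by letter. *)
Lemma correct_nrun n u : (forall a, act_below (lact a)) ->
  psum (xC n) u fV = 0 -> exists q s, nrun u q s.
Proof.
move=> below; elim/last_ind: u => [_|u a IH]; first by exists 0%N, zero_store; left.
have g1 := psum_xC_ge0 n u fV; have g2 := xC_ge0 n (rcons u a) fV.
rewrite psum_rcons => e.
have /IH[q [s r]] : psum (xC n) u fV = 0 by lia.
have /xC_V[h1 h2 h3] : xC n (rcons u a) fV = 0 by lia.
have [e1 e2] := nrun_ftotal r.
have eq : src a = q by move: h1; rewrite !ftotal_rcons /=; lia.
exists (tgt a), (act (lact a) s); apply: nrunS; first by rewrite eq.
have := below a; case ea : (lact a) => [|k|k|j k] //=.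
  move=> hk; have := h2 (Ordinal hk); have := e2 (Ordinal hk).
  rewrite /counter !ftotal_rcons /= ea.
  by rewrite !action_eqE eqxx; lia.
move=> /andP[hj hk].
have cE i : counter (rcons u a) i = counter u i.
  by rewrite /counter !ftotal_rcons /= ea !action_eqE !addr0.
have := h3 (Ordinal hj) (Ordinal hk); have := h3 (Ordinal hk) (Ordinal hj).
by rewrite !cE !e2 ea /= !eqxx orbT /= => /(_ isT) ? /(_ isT) ?; lia.
Qed.

Lemma nrun_tgt u a q s : nrun (rcons u a) q s -> q = tgt a.
Proof.
move: {-1}(rcons u a) (erefl (rcons u a)) => w e r; case: r e => [|u' a' s' _ _ /rcons_inj[_ ->]//].
by case: u.
Qed.

Lemma phiO_xA n w : (forall a, act_below (lact a)) -> (0 < size w)%N ->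
  phiO (xA n w) tt = 1 <-> exists s, nrun w qF s /\ s 1%N = n.
Proof.
case/lastP: w => // u a below _.
rewrite phiO_eq1; last exact: relu_layer_ge0.
rewrite /xA phiA_V; [|exact: psum_xC_ge0|exact: xC_ge0] => /=.
have g1 := psum_xC_ge0 n (rcons u a) fV; have g2 := xC_ge0 n (rcons u a) fSrc.
split=> [e|[s [r e]]].
  have /(correct_nrun below)[q [s r]] : psum (xC n) (rcons u a) fV = 0 by lia.
  have /xC_Src[e1 e2] : xC n (rcons u a) fSrc = 0 by lia.
  have [_ h] := nrun_ftotal r; have h1 : counter (rcons u a) reg1 = (s 1%N)%:Z := h reg1.
  exists s; split; last by rewrite h1 clip_ge0 // in e1; lia.
  by rewrite -e2 -(nrun_tgt r).
have -> := nrun_correct n r.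
have [_ h] := nrun_ftotal r; have h1 : counter (rcons u a) reg1 = (s 1%N)%:Z := h reg1.
rewrite add0r; apply/xC_Src; rewrite h1 clip_ge0 // e; split; first by lia.
by rewrite (nrun_tgt r).
Qed.

End Checker.

(** * The model, its code and its evaluation *)

Section CheckerModel.
Variables (M qF N : nat) (lab : 'I_N -> nat * action * nat).

Definition featureF : finType := feature M.
Local Notation F := featureF.

Definition netD : net #|F| (#|F| + #|F|) :=
  NetCons (sparse_layer (@dec2 F) (@dec1 (option F)) (@dHid M))
    (NetLast (sparse_layer (@dec1 (option F)) (@dec1 F) (@dOut M))).

Definition netC : net #|F| (#|F| + #|F|) :=
  NetCons (sparse_layer (@dec2 F) (@dec1 (hid1 M)) (@cHid1 M qF))
    (NetCons (sparse_layer (@dec1 (hid1 M)) (@dec1 (hid2 M)) (@cHid2 M))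
      (NetLast (sparse_layer (@dec1 (hid2 M)) (@dec1 F) (@cOut M)))).

Definition netA : net #|F| (#|F| + #|F|) :=
  NetLast (sparse_layer (@dec2 F) (@dec1 F) (@aOut M)).

Definition netO : net 1 #|F| :=
  NetLast (sparse_layer (@dec1 F) (fun _ : 'I_1 => tt) (@oOut M)).

Definition cstD := (layer_norm (@dHid M) * (layer_norm (@dOut M)).+1)%N.
Definition cstC :=
  (layer_norm (@cHid1 M qF) * (layer_norm (@cHid2 M) * (layer_norm (@cOut M)).+1).+1)%N.
Definition cstA := layer_norm (@aOut M).
Definition cstO := layer_norm (@oOut M).
(** Dominates all growth factors; the final 2 ensures [2 <= K] as soon as [cst <= K]. *)
Definition cst := (cstD + cstC + cstA + cstO + state_norm F + 2)%N.

Lemma computesD A : computes A (@dec2 F) (@dec1 F) netD (@phiD M) cstD.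
Proof.
apply: computes_cons; first exact: dec2_bij.
by apply: computes_last; exact: dec1_bij.
Qed.

Lemma computesC A : computes A (@dec2 F) (@dec1 F) netC (@phiC M qF) cstC.
Proof.
apply: (computes_cons (phi := fun x => relu_layer (@cOut M) (relu_layer (@cHid2 M) x))).
  exact: dec2_bij.
apply: computes_cons; first exact: dec1_bij.
by apply: computes_last; exact: dec1_bij.
Qed.

Lemma computesA A : computes A (@dec2 F) (@dec1 F) netA (@phiA M) cstA.
Proof. by apply: computes_last; exact: dec2_bij. Qed.

Lemma computesO A : computes A (@dec1 F) (fun _ : 'I_1 => tt) netO (@phiO M) cstO.
Proof. by apply: computes_last; exact: dec1_bij. Qed.

Definition checker n : ssm :=
  SSM [ffun a => \col_i ((feat lab a (dec1 i))%:Z)%:~R]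
    (in_tuple [seq @sum_layer F L | L <- nseq n netD ++ [:: netC; netA]]) netO.

Lemma checker_gate n (j : 'I_(nlayers (checker n))) :
  gate (tnth (layers (checker n)) j) = GateConst 1%:M.
Proof.
rewrite (tnth_nth (@sum_layer F netA)) /= (nth_map netA) //.
by rewrite -(size_map (@sum_layer F)); exact: (ltn_ord j).
Qed.

(** Only the number of copies depends on [n]; the embedding does not, and is read off
    [checker 0]. *)
Lemma checker_code n : enc_ssm (checker n) =
  template_code #|F| N
    (CodeSeq.code [seq enc_mx (emb (checker 0) a) | a <- enum 'I_N])
    (enc_ssm_layer (sum_layer netD))
    (CodeSeq.code [:: enc_ssm_layer (sum_layer netC); enc_ssm_layer (sum_layer netA)])
    (CodeSeq.code [:: enc_net netO]) n.
Proof.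
have h d r : CodeSeq.code (nseq n d ++ r) = iter n (code_cons d) (CodeSeq.code r).
  by elim: n => //= k ->.
rewrite /template_code -h /enc_ssm.
have -> : [seq enc_ssm_layer l | l <- layers (checker n)] = nseq n (enc_ssm_layer (sum_layer netD))
    ++ [:: enc_ssm_layer (sum_layer netC); enc_ssm_layer (sum_layer netA)].
  by rewrite /= !map_cat !map_nseq.
by [].
Qed.

Lemma norm_ftotal (u : seq 'I_N) (f : feature M) (q : nat) : (forall a, feat lab a f <= q)%N ->
  0 <= ftotal lab u f <= (size u * q)%N%:Z.
Proof.
move=> h; elim/last_ind: u => [|u a IH]; first by rewrite ftotal_nil.
by rewrite ftotal_rcons size_rcons mulSn; have := h a; lia.
Qed.

(** Each letter changes a counter by at most 1, so its absolute value is at most [K], and clipping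
    adds at most 1. *)
Lemma norm_xD n (K : nat) u (f : feature M) :
  (0 < size u <= K)%N -> (forall a (f : feature M), feat lab a f <= K)%N ->
  `|xD (M := M) lab n u f| <= (2 * K)%N%:Z.
Proof.
case/lastP: u => // u a hs hK; case: f => [f|].
  by rewrite xD_S ger0_norm // lez_nat; apply: leq_trans (hK a _) _; lia.
rewrite xD_V.
have h1 (b : bool) : (b <= 1)%N by case: b.
have := norm_ftotal (rcons u a) (f := fInc (reg1 M)) (q := 1) (fun c => h1 _).
have := norm_ftotal (rcons u a) (f := fDec (reg1 M)) (q := 1) (fun c => h1 _).
have := clip_bound n (counter lab (rcons u a) (reg1 M)).
by rewrite /counter; lia.
Qed.

(** Each of the two checking layers costs a factor [K] for its constant and one for the length: from
    [2 * K <= K ^ 2] the bounds become [K ^ 4] and [K ^ 6]. The output needs [K ^ 7], and the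
    intermediate values stay below [K ^ 8]. *)
Lemma checker_eval A b n (K : nat) w :
  exact_upto A b (K ^ 8) -> (cst <= K)%N -> (forall a f, feat (M := M) lab a f <= K)%N ->
  (0 < size w <= K)%N ->
  exists2 y, @ssm_eval (fw_arith A b) (checker n) w = Some y &
    rep (y : fw_num A b) (phiO (xA (M := M) qF lab n w) tt).
Proof.
move=> hB hc hK hw; have [u [a ew]] : exists u a, w = rcons u a.
  by case/lastP: w hw => // u a _; exists u, a.
rewrite ew ssm_eval_rcons -ew; eexists; first by [].
have K2 : (2 <= K)%N by rewrite /cst in hc; lia.
pose X0 : seq 'I_N -> 'cV[fw_arith A b]_#|F| := @last_emb (fw_arith A b) (checker n).
have -> : tval (layers (checker n)) =
    nseq n (sum_layer netD) ++ [:: sum_layer netC; sum_layer netA].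
  by rewrite /= map_cat map_nseq.
rewrite foldl_cat -/X0.
have foldl_nseq T (f : ssm_layer #|F| -> T -> T) l k (x : T) :
    foldl (fun x l => f l x) x (nseq k l) = iter k (f l) x.
  by elim: k x => // k IH x; rewrite iterSr -IH.
rewrite (foldl_nseq _ (fun l X => lift_layer l X)) [foldl _ _ _]/=.
have P2 : (2 * K <= K ^ 2)%N by rewrite expnS expn1 leq_mul2r K2 orbT.
have E k : (K ^ k.+1 = K * K ^ k)%N by rewrite expnS.
have mono i j : (i <= j)%N -> (K ^ i <= K ^ j)%N by move=> ij; rewrite leq_pexp2l //; lia.
have prod3 c k e : (c <= K)%N -> (e <= K ^ k)%N -> (c * (K * e) <= K ^ k.+2)%N.
  by move=> hck hek; rewrite !E leq_mul // leq_mul.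
have K0 : (0 < 2 * K)%N by lia.
have hD : ((cstD + state_norm F) * (K * (2 * K)) <= K ^ 8)%N.
  apply: leq_trans (mono 4%N 8%N isT); apply: prod3 => //.
  by move: hc; rewrite /cst; lia.
have hD' : ((cstC + state_norm F) * (K * (2 * K)) <= K ^ 8)%N.
  apply: leq_trans (mono 4%N 8%N isT); apply: prod3 => //.
  by move: hc; rewrite /cst; lia.
have norm_xD_K k v f (hv : (0 < size v <= K)%N) : `|xD (M := M) lab k v f| <= (2 * K)%N%:Z.
  exact: norm_xD.
have rD k v : (0 < size v <= K)%N ->
    reps (@dec1 F) (iter k (lift_layer (sum_layer netD)) X0 v) (xD lab k v).
  elim: k v => [|k IH] v hv.
    case/lastP: v hv => // v c hv i; rewrite /X0 /last_emb /= map_rcons last_rcons mxE ffunE mxE.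
    rewrite /x0 map_rcons last_rcons; apply: (rep_round hB).
    rewrite ger0_norm // lez_nat; apply: leq_trans (hK c _) _.
    by rewrite -{1}[K]expn1; apply: mono.
  exact: (rep_lift_layer hB (@computesD A) K0 hD IH (norm_xD_K k) hv).1.
have hC v : (0 < size v <= K)%N ->
    reps (@dec1 F) (lift_layer (sum_layer netC)
      (iter n (lift_layer (sum_layer netD)) X0) v) (xC qF lab n v) /\
    forall f : feature M, `|xC qF lab n v f| <= (K ^ 4)%N%:Z.
  move=> hv; have [r1 r2] := rep_lift_layer hB (@computesC A) K0 hD' (rD n) (norm_xD_K n) hv.
  split=> // f; apply: (@le_trans _ _ (cstC * (K * (2 * K)))%N%:Z); first exact: r2.
  by rewrite lez_nat; apply: prod3 => //; move: hc; rewrite /cst; lia.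
have K4 : (0 < K ^ 4)%N by rewrite expn_gt0; lia.
have hA : ((cstA + state_norm F) * (K * K ^ 4) <= K ^ 8)%N.
  apply: leq_trans (mono 6%N 8%N isT); apply: prod3 => //.
  by move: hc; rewrite /cst; lia.
have [rA1 rA2] := rep_lift_layer hB (@computesA A) K4 hA (fun v hv => (hC v hv).1)
  (fun v f hv => (hC v hv).2 f) hw.
have K6 : (0 < K ^ 6)%N by rewrite expn_gt0; lia.
have hO : (cstO * K ^ 6 <= K ^ 8)%N.
  apply: leq_trans (mono 7%N 8%N isT); rewrite (E 6%N) leq_mul2r; apply/orP; right.
  by move: hc; rewrite /cst; lia.
have hxA (f : feature M) : `|xA qF lab n w f| <= (K ^ 6)%N%:Z.
  apply: (@le_trans _ _ (cstA * (K * K ^ 4))%N%:Z); first exact: rA2.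
  by rewrite lez_nat; apply: prod3 => //; move: hc; rewrite /cst; lia.
exact: ((@computesO A b (K ^ 8)%N (K ^ 6)%N _ _ hB K6 hO rA1 hxA).1 ord0).
Qed.

End CheckerModel.

(** * The reduction *)

Section MachineWords.
Variables (P : prog) (l0 : letter).
Hypothesis l0P : l0 \in letters P.
Local Open Scope nat_scope.

(** The terminal continuation lies outside [conts P [::]] and is appended at the end, so that the
    initial one keeps number 0. *)
Definition points := rcons (conts P [::]) [::].
Definition idx (K : seq prog) := index K points.

Definition max_reg (a : action) :=
  match a with
  | ANop => 0
  | AInc r | ADec r => r
  | AEq i j => maxn i j
  end.
Definition regs := \max_(l <- letters P) max_reg l.1.2.

(* The alphabet is padded so that the weights of the model are at most its size. *)
Definition alphabet := (size (letters P) + size points + cst regs (idx [::])).+1.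

(** All padding letters stand for the genuine transition [l0], so they add no behaviour. *)
Definition letter_of (a : 'I_alphabet) : letter := nth l0 (letters P) a.
Definition label (a : 'I_alphabet) :=
  (idx (letter_of a).1.1, (letter_of a).1.2, idx (letter_of a).2).

Lemma letter_ofP a : letter_of a \in letters P.
Proof.
rewrite /letter_of; case: (ltnP a (size (letters P))) => h; first exact: mem_nth.
by rewrite nth_default.
Qed.

Lemma letter_of_surj l : l \in letters P -> exists a, letter_of a = l.
Proof.
move=> hl; have h : index l (letters P) < alphabet.
  by rewrite (@leq_trans (size (letters P))) ?index_mem // /alphabet; lia.
by exists (Ordinal h); rewrite /letter_of /= nth_index.
Qed.

Lemma idx_inj K K' : K \in points -> idx K = idx K' -> K = K'.
Proof.
move=> hK e; have hK' : K' \in points by rewrite -index_mem -/(idx K') -e index_mem.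
by rewrite -(nth_index [::] hK) -(nth_index [::] hK') -/(idx K) e.
Qed.

Lemma idx_start : idx [:: P] = 0.
Proof. by rewrite /idx /points; case: P => *; rewrite /= eqxx. Qed.

Lemma label_below a : act_below regs (label a).1.2.
Proof.
rewrite /label /=; have := letter_ofP a; move: (letter_of a) => l hl.
have : max_reg l.1.2 <= regs by apply: leq_bigmax_seq.
by rewrite /act_below; case: l.1.2 => //= *; lia.
Qed.

Lemma feat_bound a (f : feature regs) : feat label a f <= alphabet.
Proof.
have hp K : idx K <= alphabet.
  rewrite /alphabet -addnS; apply: leq_trans (index_size _ _) _.
  exact: leq_trans (leq_addl _ _) (leq_addr _ _).
have hb (b : bool) : b <= alphabet by case: b.
by case: f => [[[[[i|i]|[i j]]|]|]|] /=; rewrite ?hb ?hp.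
Qed.

Lemma run_points u K s : run P zero_store u K s -> K \in points.
Proof. by move=> /run_conts; rewrite mem_rcons inE orbC. Qed.

Lemma nrun_run w q s : nrun label w q s ->
  exists2 K, q = idx K & run P zero_store (map letter_of w) K s.
Proof.
elim=> {w q s} [|w a s _ [K e r] g]; first by exists [:: P]; [rewrite idx_start|exact: run0].
exists (letter_of a).2 => //; rewrite map_rcons.
have eK : K = (letter_of a).1.1 by apply: idx_inj (esym e); apply: run_points r.
have := letter_ofP a; move: eK g; rewrite /label /lact /=.
by case: (letter_of a) => -[K1 b] K2 /= <- g hl; apply: runS.
Qed.

Lemma run_nrun u K s : run P zero_store u K s ->
  exists2 w, map letter_of w = u & nrun label w (idx K) s.
Proof.
elim=> {u K s} [|u K b K' s _ [w ew r] hl g].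
  by exists [::] => //; rewrite idx_start; apply: nrun0.
have [a ea] := letter_of_surj hl.
exists (rcons w a); first by rewrite map_rcons ea ew.
have := @nrunS _ label w a s; rewrite /src /lact /tgt /label ea /=; exact.
Qed.

Lemma checker_run n :
  (exists w, 0 < size w /\ phiO (xA (M := regs) (idx [::]) label n w) tt = 1%R) <->
  (exists u s, run P zero_store u [::] s /\ s 1 = n).
Proof.
split=> [[w [hw e1]]|[u [s [r e]]]].
  have [s [r e]] := (@phiO_xA regs (idx [::]) alphabet label n w label_below hw).1 e1.
  have [K eK rK] := nrun_run r; exists (map letter_of w), s; split=> //.
  by rewrite (@idx_inj [::] K) // mem_rcons mem_head.
have [w ew rw] := run_nrun r; exists w.
(* The empty run ends at [[:: P]], which is not the terminal point. *)
have hw : 0 < size w.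
  suff h K : run P zero_store u K s -> K = [::] -> 0 < size u.
    by rewrite -(size_map letter_of) ew (h _ r).
  by case=> // *; rewrite size_rcons.
by split=> //; apply/(@phiO_xA regs (idx [::]) alphabet label n w label_below hw); exists s.
Qed.

End MachineWords.

(** * Logarithmic precision and the diagonal argument *)

Lemma exact_upto_log A : exists c0 : nat, forall n b, (2 <= n)%N ->
  (c0 * trunc_log 2 n <= b)%N -> exact_upto A b (n ^ 8).
Proof.
(* For [n >= 2], [n < 2 ^ (2 * trunc_log 2 n)], hence [n ^ 8 < 2 ^ (16 * trunc_log 2 n)]; the factor
   [k] accounts for the share of the bits that holds integers. *)
have [k k0 hk] := fw_range A; exists (16 * k)%N => n b n2 hb z hz; apply: hk.
apply: le_lt_trans hz _; rewrite ltz_nat.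
have h1 : (n < 2 ^ (trunc_log 2 n * 2))%N.
  apply: leq_trans (trunc_log_ltn n (isT : 1 < 2)%N) _.
  by rewrite leq_exp2l // ; have := trunc_log_max (isT : (1 < 2)%N) (n2 : (2 ^ 1 <= n)%N); lia.
apply: leq_trans (_ : (2 ^ (trunc_log 2 n * 2)) ^ 8 <= _)%N; first by rewrite ltn_exp2r.
rewrite -expnM leq_exp2l // leq_divRL //; lia.
Qed.

Lemma ssm_eval_nil (A : arith) (S : ssm) : @ssm_eval A S [::] = None.
Proof.
rewrite /ssm_eval /=.
by rewrite (ssm_layers_prefixes (layers S) (@last_emb A S) [::]).
Qed.

Local Close Scope ring_scope.

Theorem theorem4 (R : realType) (A : fixed_width) :
  exists c0 : nat, forall p : nat -> nat,
    (forall n, c0 * trunc_log 2 n <= p n) -> O_log p ->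
    ~ decidable_on (fun S => time_invariant S /\ diagonal R S)
                   (ssmSAT_fix A p).
Proof.
have [c0 hc0] := exact_upto_log A; exists c0 => p hp _ [f hf].
have [g hg] := diagonal_halting f.
pose P := main_prog g.
(* The first transition of the program serves as padding letter. *)
pose l0 : letter := ([:: P], ANop, [:: PStar (PInc 1); compile g [tuple 1%N] 2 3]).
have l0P : l0 \in letters P by apply: mem_letters; rewrite ?mem_conts ?mem_head.
pose S n := checker (regs P) (idx P [::]) (label (P := P) l0) n.
have hS n : time_invariant (S n) /\ diagonal R (S n).
  split=> [j|j x]; first by exists 1%:M%R; apply: checker_gate.
  by rewrite /gate_eval checker_gate /= map_mx1 scalar_mx_is_diag.
have sat n : ssmSAT_fix A p (S n) <-> exists y, mu_eval g [tuple n] y.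
  rewrite -(main_progP g n) -(checker_run l0P).
  have ev (w : seq 'I_(alphabet P)) : (0 < size w)%N ->
      exists2 y, @ssm_eval (fw_arith A (p (maxn (alphabet P) (size w)))) (S n) w = Some y &
        rep (y : fw_num A _) (phiO (xA (M := regs P) (idx P [::]) (label (P := P) l0) n w) tt).
    move=> hw; have hN : (cst (regs P) (idx P [::]) < alphabet P)%N by rewrite /alphabet; lia.
    have h2 : (2 <= cst (regs P) (idx P [::]))%N by rewrite /cst; lia.
    (* [K] is the argument of [p]: it dominates the weights through the alphabet and the sums
       through the length. *)
    apply: (checker_eval (K := maxn (alphabet P) (size w))) => //; last by rewrite hw leq_maxr.
    - by apply: hc0; [lia|exact: hp].
    - by lia.
    - by move=> a h; apply: leq_trans (feat_bound _ _ _) (leq_maxl _ _).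
  split=> [[w [y [ey y1]]]|[w [hw e1]]].
    have hw : (0 < size w)%N by case: w y ey y1 => // y; rewrite ssm_eval_nil.
    exists w; split=> //; have [y' ey' ry'] := ev w hw.
    move: ry'; have -> : y' = y by move: ey; rewrite ey' => -[].
    by rewrite /rep y1 => -[] /(intr_inj (x1 := 1%R)) <-.
  have [y ey ry] := ev w hw; exists w, y; split=> //.
  by rewrite ry e1.
have [e [k [D [r [o [d hE]]]]]] : exists e k D r o d, forall n,
    enc_ssm (S n) = template_code d k e D r o n.
  by do 6!eexists; move=> n; apply: checker_code.
(* The fixed point: the number of copies packs the constants of the model itself. *)
pose n := pack d k e D r o.
have [b evb hb] := hf (S n) (hS n).
have ediag : enc_ssm (S n) = diag_code n by rewrite hE diag_codeE.
(* On [n], [g] halts iff the answer [b] is false, while by [sat] and [hb] it halts iff [b] is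
   true. *)
rewrite ediag in evb; have := hg n _ evb; rewrite -sat -hb.
by case: b {evb hb} => -[h1 h2]; [have := h1 isT|have := h2 erefl].
Qed.
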